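(* Let $\theta_1,\dots,\theta_r$ be real numbers, with $d$, $\nu_\theta$ and the random variable $Z_\theta$ as defined in the context, and let $f_1,\dots,f_D\in\mathbb{C}(X_1,\dots,X_r)$ be real-valued and without pole on $\mathbb{T}^r$. Let $G=(G_1,\dots,G_D):t\mapsto(F_1(t),\dots,F_D(t))+r(t)$, where $F_j(t)=f_j(e^{i\theta_1t},\dots,e^{i\theta_rt})$ for $1\le j\le D$, and $r(t)=(r_1(t),\dots,r_D(t))\in\mathbb{R}^D$ satisfies $r(t)=o(1)$ as $t\to+\infty$. (i) Degenerate case: assume that $\theta_i\in\pi\mathbb{Q}$ for $1\le i\le r$. Then $$\mathbb{P}(f_1(Z_\theta)>\dots>f_D(Z_\theta))\le\underline{\delta}(G_1>\dots>G_D)\le\overline{\delta}(G_1>\dots>G_D)\le\mathbb{P}(f_1(Z_\theta)\ge\dots\ge f_D(Z_\theta)).$$ In particular, if for every $1\le j\le D-1$ and every $n\in\mathbb{Z}$ one has $F_j(n)\ne F_{j+1}(n)$, then $\delta(G_1>\dots>G_D)$ exists and $$\delta(G_1>\dots>G_D)=\mathbb{P}(f_1(Z_\theta)>\dots>f_D(Z_\theta)).$$ (ii) Non-degenerate case: assume $\theta_i\notin\pi\mathbb{Q}$ for at least one $i\in\{1,\dots,r\}$. Then $$\frac1d\sum_{a=0}^{d-1}\mathbb{P}(f_1(\nu_\theta^aZ_\theta)>\dots>f_D(\nu_\theta^aZ_\theta))\le\underline{\delta}(G_1>\dots>G_D)\le\overline{\delta}(G_1>\dots>G_D)\le\frac1d\sum_{a=0}^{d-1}\mathbb{P}(f_1(\nu_\theta^aZ_\theta)\ge\dots\ge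 f_D(\nu_\theta^aZ_\theta)).$$ Moreover, if for every $1\le j\le D-1$ and $0\le a\le d-1$ there exists $n\equiv a\bmod d$ such that $F_j(n)\ne F_{j+1}(n)$, then $\delta(G_1>\dots>G_D)$ exists and $$\delta(G_1>\dots>G_D)=\frac1d\sum_{a=0}^{d-1}\mathbb{P}(f_1(\nu_\theta^aZ_\theta)>\dots>f_D(\nu_\theta^aZ_\theta)).$$
   Context: $\mathbb{T}=\{z\in\mathbb{C}:|z|=1\}$, and $\mathbb{T}^r$ is a group under coordinatewise multiplication. A rational function has no pole on $\mathbb{T}^r$ if it can be written $P/Q$ with polynomials $P,Q$ such that $Q$ does not vanish on $\mathbb{T}^r$; it is real-valued on $\mathbb{T}^r$ if it takes real values there. $\underline{\delta}(G_1>\dots>G_D)$ and $\overline{\delta}(G_1>\dots>G_D)$ are the $\liminf$ and $\limsup$ as $X\to+\infty$ of $\frac1X\#\{n\in\{1,\dots,X\}:G_1(n)>\dots>G_D(n)\}$; when they are equal, $\delta(G_1>\dots>G_D)$ exists and denotes their common value. Let $m\ge0$ be defined by $m+1=\dim_{\mathbb{Q}}\mathrm{Span}_{\mathbb{Q}}(\pi,\theta_1,\dots,\theta_r)$. After reindexing the $\theta_i$ (and correspondingly the variables $X_i$), it is assumed that $\{2\pi,\theta_1,\dots,\theta_m\}$ is a basis of this $\mathbb{Q}$-vector space, and one writes $\theta_j=2\pi c_j+\sum_{k=1}^m b_{k,j}\theta_k$ for $m+1\le j\le r$, with $c_j,b_{k,j}\in\mathbb{Q}$. Let $d\ge1$ be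 the least common multiple of the denominators of all the $c_j$ and $b_{k,j}$ ($d=1$ if $m=r$), $h_{k,j}=d\,b_{k,j}\in\mathbb{Z}$, and $\nu_\theta=(e^{i\theta_1},\dots,e^{i\theta_r})$. The random variable $Z_\theta$ with values in $\mathbb{T}^r$: if $m=0$ (degenerate case), $Z_\theta$ is uniform on the finite cyclic group $\langle\nu_\theta\rangle$; if $m\ge1$ (non-degenerate case), $Z_\theta=\left(Z_1^d,\dots,Z_m^d,\prod_{k=1}^mZ_k^{h_{k,m+1}},\dots,\prod_{k=1}^mZ_k^{h_{k,r}}\right)$ where $Z_1,\dots,Z_m$ are independent uniform random variables on $\mathbb{T}$. *)

(* Defs.v *)
From HB Require Import structures.
From mathcomp Require Import all_boot all_order all_algebra finmap.
From mathcomp Require Import complex.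
(* The notations of mpoly clash with those of mathcomp-analysis; the canonical
   structures on mpoly are still needed, hence the filtered Import. *)
From mathcomp Require Import -(notations) mpoly.
From mathcomp Require Import all_classical all_reals all_analysis.

Set Implicit Arguments.
Unset Strict Implicit.
Unset Printing Implicit Defensive.

Import Order.TTheory GRing.Theory Num.Theory numFieldNormedType.Exports.

Local Open Scope classical_set_scope.
Local Open Scope complex_scope.
Local Open Scope ring_scope.

(* Borel sigma-algebra on the complex numbers, transported from R * R. *)

Definition complex_pair (R : realType) (z : R[i]) : R * R :=
  (complex.Re z, complex.Im z).

HB.instance Definition _ (R : realType) := Pointed.copy R[i] (R[i]^o).
HB.instance Definition _ (R : realType) :=
  Measurable.copy R[i] (g_sigma_algebra_preimageType (@complex_pair R)).

Definition expi (R : realType) (t : R) : R[i] := cos t +i* sin t.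

Definition torus (R : realType) (r : nat) : set ('I_r -> R[i]) :=
  [set z | forall i, `|z i| = 1].

Notation ratfun R r := {fraction (mpoly r R[i])}.

Definition is_frac (R : realType) (r : nat) (f : ratfun R r)
    (p q : mpoly r R[i]) : Prop :=
  q != 0 /\ f = tofrac p / tofrac q.

Definition no_pole_on_torus (R : realType) (r : nat) (f : ratfun R r) : Prop :=
  exists p q : mpoly r R[i],
    is_frac f p q /\ (forall z, torus z -> meval z q != 0).

(* The value of f at z: p(z)/q(z) for any representation f = p/q such that
   q(z) != 0 (see ratfun_evalE), and 0 if there is none. *)
Definition ratfun_eval (R : realType) (r : nat) (f : ratfun R r)
    (z : 'I_r -> R[i]) : R[i] :=
  xget 0 [set w | exists p q : mpoly r R[i],
    [/\ is_frac f p q, meval z q != 0 & w = meval z p / meval z q]].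

Definition real_on_torus (R : realType) (r : nat) (f : ratfun R r) : Prop :=
  forall z, torus z -> ratfun_eval f z \is Num.real.

Definition ratfun_Re (R : realType) (r : nat) (f : ratfun R r)
    (z : 'I_r -> R[i]) : R :=
  complex.Re (ratfun_eval f z).

Lemma ratfun_evalE (R : realType) (r : nat) (f : ratfun R r)
    (z : 'I_r -> R[i]) (p q : mpoly r R[i]) :
  is_frac f p q -> meval z q != 0 -> ratfun_eval f z = meval z p / meval z q.
Proof.
move=> [q0 fpq] qz; rewrite /ratfun_eval; case: xgetP => [w _|]; last first.
  by move=> /(_ (meval z p / meval z q))[]; exists p, q.
move=> [p' [q' [[q'0 fpq'] q'z ->]]].
apply/eqP; rewrite eqr_div// -!mevalM; apply/eqP; congr meval.
apply/eqP; rewrite -(tofrac_eq (R := mpoly r R[i])).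
rewrite !tofracM -eqr_div ?tofrac_eq0//.
by rewrite -fpq -fpq'.
Qed.

Definition strict_chain (R : realType) (D : nat) (x : 'I_D -> R) : bool :=
  sorted >%R [seq x j | j : 'I_D].

Definition weak_chain (R : realType) (D : nat) (x : 'I_D -> R) : bool :=
  sorted >=%R [seq x j | j : 'I_D].

Definition chain_freq (R : realType) (D : nat) (G : 'I_D -> R -> R)
    (X : nat) : R :=
  (count (fun n => strict_chain (fun j => G j n%:R)) (iota 1 X))%:R / X%:R.

Definition lower_density (R : realType) (D : nat) (G : 'I_D -> R -> R) :
    \bar R :=
  limn_einf (fun X => (chain_freq G X)%:E).

Definition upper_density (R : realType) (D : nat) (G : 'I_D -> R -> R) :
    \bar R :=
  limn_esup (fun X => (chain_freq G X)%:E).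

Definition has_density (R : realType) (D : nat) (G : 'I_D -> R -> R)
    (v : \bar R) : Prop :=
  lower_density G = upper_density G /\ lower_density G = v.

Definition in_piQ (R : realType) (x : R) : Prop :=
  exists q : rat, x = pi * ratr q.

Definition Qspan (R : realType) (I : finType) (v : I -> R) : set R :=
  range (fun a : I -> rat => \sum_(i : I) ratr (a i) * v i).

Definition Qfree (R : realType) (I : finType) (v : I -> R) : Prop :=
  forall a : I -> rat, \sum_(i : I) ratr (a i) * v i = 0 -> a =1 (fun=> 0).

Definition Qbasis (R : realType) (I : finType) (V : set R) (v : I -> R) : Prop :=
  Qfree v /\ Qspan v = V.

(* The angles are indexed by 'I_(m + s): the first m ones are the theta_k with
   k <= m, the last s ones are the theta_j with m < j <= r := m + s. *)

Definition angles_span (R : realType) (r : nat) (theta : 'I_r -> R) : set R :=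
  Qspan (oapp theta pi).

(* The m + 1 numbers 2 pi, theta_1, ..., theta_m, indexed by option 'I_m. *)
Definition angles_basis (R : realType) (m s : nat) (theta : 'I_(m + s) -> R) :
    option 'I_m -> R :=
  oapp (fun k => theta (lshift s k)) (2 * pi).

Definition lcm_denoms (m s : nat) (c : 'I_s -> rat) (b : 'I_m -> 'I_s -> rat) :
    nat :=
  \big[lcmn/1%N]_(j < s)
    lcmn `|denq (c j)|%N (\big[lcmn/1%N]_(k < m) `|denq (b k j)|%N).

(* The integer d * b_{k,j}, see hcoefE. *)
Definition hcoef (m s : nat) (c : 'I_s -> rat) (b : 'I_m -> 'I_s -> rat)
    (k : 'I_m) (j : 'I_s) : int :=
  numq ((lcm_denoms c b)%:R * b k j).

Lemma hcoefE (m s : nat) (c : 'I_s -> rat) (b : 'I_m -> 'I_s -> rat)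
    (k : 'I_m) (j : 'I_s) :
  (hcoef c b k j)%:~R = (lcm_denoms c b)%:R * b k j.
Proof.
rewrite /hcoef; set x := _ * _.
suff : x \is a Num.int by move=> /intrP[n ->]; rewrite numq_int.
have /dvdnP[e de] : (`|denq (b k j)| %| lcm_denoms c b)%N.
  rewrite /lcm_denoms (bigD1 j)//= (bigD1 k)//=.
  apply: dvdn_trans (dvdn_lcml _ _).
  apply: dvdn_trans (dvdn_lcmr _ _).
  exact: dvdn_lcml.
have -> : x = (e%:Z * numq (b k j))%:~R.
  have absE : `|denq (b k j)|%N%:R = (denq (b k j))%:~R :> rat.
    by rewrite -[in RHS]absz_denq.
  by rewrite /x de natrM absE intrM numqE -mulrA (mulrC (b k j)).
by rewrite intr_int.
Qed.

Definition nu (R : realType) (r : nat) (theta : 'I_r -> R) : 'I_r -> R[i] :=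
  fun i => expi (theta i).

Definition cyclic_subgroup (R : realType) (r : nat) (z : 'I_r -> R[i]) :
    set ('I_r -> R[i]) :=
  range (fun (k : int) i => z i ^ k).

Definition uniform_on_finite (R : realType) (dO : measure_display)
    (Omega : measurableType dO) (P : probability Omega R) (r : nat)
    (A : set ('I_r -> R[i])) (Z : 'I_r -> {RV P >-> R[i]}) : Prop :=
  finite_set A /\
  forall z, A z -> P [set w | Z ^~ w = z] = (#|` fset_set A|%:R^-1)%:E.

Lemma pi2_gt0 (R : realType) : 0 < 2 * pi :> R.
Proof. by rewrite mulr_gt0// pi_gt0. Qed.

(* |Z| = 1 everywhere, and the law of Z is the image of the uniform law on
   [0, 2 pi] by t |-> e^{it}. *)
Definition uniform_on_circle (R : realType) (dO : measure_display)
    (Omega : measurableType dO) (P : probability Omega R)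
    (Z : {RV P >-> R[i]}) : Prop :=
  (forall w, `|Z w| = 1) /\
  forall A : set R[i], measurable A ->
    distribution P Z A = uniform_prob (pi2_gt0 R) (@expi R @^-1` A).

(* Taking some of the A k equal to setT gives the product rule for every
   subfamily. *)
Definition independent_RVs (R : realType) (dO : measure_display)
    (Omega : measurableType dO) (P : probability Omega R) (m : nat)
    (Z : 'I_m -> {RV P >-> R[i]}) : Prop :=
  forall A : 'I_m -> set R[i], (forall k, measurable (A k)) ->
    P (\bigcap_(k in [set: 'I_m]) (Z k @^-1` A k)) =
    (\prod_(k < m) P (Z k @^-1` A k))%E.

Definition is_Ztheta (R : realType) (dO : measure_display)
    (Omega : measurableType dO) (P : probability Omega R) (m s : nat)
    (theta : 'I_(m + s) -> R) (c : 'I_s -> rat) (b : 'I_m -> 'I_s -> rat)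
    (Z : 'I_(m + s) -> {RV P >-> R[i]}) : Prop :=
  (forall w, torus (Z ^~ w)) /\
  if m == 0%N then uniform_on_finite (cyclic_subgroup (nu theta)) Z
  else exists Y : 'I_m -> {RV P >-> R[i]},
    [/\ forall k, uniform_on_circle (Y k),
        independent_RVs Y,
        forall k w, Z (lshift s k) w = Y k w ^+ lcm_denoms c b
      & forall j w, Z (rshift m j) w = \prod_(k < m) Y k w ^ hcoef c b k j].

Definition strict_prob (R : realType) (dO : measure_display)
    (Omega : measurableType dO) (P : probability Omega R) (r D : nat)
    (f : 'I_D -> ratfun R r) (Z : Omega -> 'I_r -> R[i]) : \bar R :=
  P [set w | strict_chain (fun j => ratfun_Re (f j) (Z w))].

Definition weak_prob (R : realType) (dO : measure_display)
    (Omega : measurableType dO) (P : probability Omega R) (r D : nat)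
    (f : 'I_D -> ratfun R r) (Z : Omega -> 'I_r -> R[i]) : \bar R :=
  P [set w | weak_chain (fun j => ratfun_Re (f j) (Z w))].

Definition Fcurve (R : realType) (r D : nat) (theta : 'I_r -> R)
    (f : 'I_D -> ratfun R r) (j : 'I_D) (t : R) : R :=
  ratfun_Re (f j) (fun i => expi (theta i * t)).

(* Main.v *)
Require Import Defs.
From HB Require Import structures.
From mathcomp Require Import all_boot all_order all_algebra finmap.
From mathcomp Require Import complex.
From mathcomp Require Import -(notations) mpoly.
From mathcomp Require Import all_classical all_reals all_analysis.
From mathcomp Require Import measurable_realfun ring lra.

Set Implicit Arguments.
Unset Strict Implicit.
Unset Printing Implicit Defensive.

Import Order.TTheory GRing.Theory Num.Theory numFieldNormedType.Exports.

Local Open Scope classical_set_scope.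
Local Open Scope complex_scope.
Local Open Scope ring_scope.

(** Write [Y = (Y_1, ..., Y_m)] for independent uniform variables on the circle.

  Along a progression [n = a + d * q] the values of the rational functions are
  functions of the orbit point [(e^(i theta_1 q), ..., e^(i theta_m q))] of the
  torus of dimension [m], because [d] clears the denominators of the coordinates
  of the other angles ([orbit_translate]); substituting [Y] for the orbit point
  gives the variable [nu ^ a * Z]. A chain of strict inequalities is the
  positivity of one function: if [Re (f j) = A j / B j], with [A j] and [B j]
  polynomials in real and imaginary parts and [B j > 0] on the torus, it says
  that the minimum [h] of the cross differences [A j * B k - A k * B j] over
  consecutive [j], [k] is positive, while the weak chain is the failure of
  [- h > 0]. Moreover [h > r] for a fixed [r > 0] forces a gap between
  consecutive values that a perturbation [o(1)] cannot close
  ([chain_fun_stable]).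

  Both density bounds then follow from one inequality, applied to [h] and to
  [- h]: for every [e > 0] there is [r > 0] such that the frequency of [h > r]
  along the orbit is eventually at least [P (h Y > 0) - e]
  ([weyl_lower_bound]). It is Weyl's theorem in a form that avoids integrals.
  Regular grids of the torus and orbits of rationally independent angles are
  both equidistributed, in that their averages of nontrivial characters tend to
  [0]; so they have the same limiting averages for uniform limits of
  trigonometric polynomials, in particular for piecewise polynomial functions
  ([plfun_approx], [avg_near]). The law of [Y] is compared with the grid alone:
  the cells of the grid are products of arcs, hence independence bounds the
  probability of an event by the proportion of cells that it meets
  ([prob_le_avg_grid]).

  The two bounds agree when consecutive functions differ somewhere on each
  progression, because a trigonometric polynomial that is not identically zero
  on the torus vanishes at [Y] with probability [0] ([prob_zero_set]). Indeed its
  restriction to the cosets of a suitable one-parameter subgroup is a nonzero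
  polynomial of fixed degree [M], so that among [K] rotates of its zero set by
  elements of this subgroup at most [M] contain a given point, while all of them
  have the same mean.

  For [m = 0] the torus is a point and the general bounds count the [a < d] for
  which the chain holds at [nu ^ a]. As [d] is the order of [nu], this is the
  probability for the uniform law on the cyclic group ([prob_cyclic]). *)

(** * Unit complex numbers *)

Local Notation normc := Normc.normc.

Section UnitCircle.
Variable R : realType.
Implicit Types (z w : R[i]) (x t : R).

Lemma normr_normc z : `|z| = (normc z)%:C.
Proof. by rewrite normc_def; case: z. Qed.

Lemma normr_eq1 z : (`|z| = 1) <-> (normc z = 1).
Proof. by rewrite normr_normc; split=> [/complexI|->]. Qed.

Lemma normc_ge0 z : 0 <= normc z.
Proof. by case: z => a b; exact: sqrtr_ge0. Qed.

Lemma normc_sqr z : normc z ^+ 2 = complex.Re z ^+ 2 + complex.Im z ^+ 2.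
Proof. by case: z => a b /=; rewrite sqr_sqrtr// addr_ge0 ?sqr_ge0. Qed.

Lemma normcX z n : normc (z ^+ n) = normc z ^+ n.
Proof.
by elim: n => [|n IH]; rewrite ?expr0 ?Normc.normc1// !exprS Normc.normcM IH.
Qed.

Lemma normc_sum (I : Type) (r : seq I) (P : pred I) (F : I -> R[i]) :
  normc (\sum_(i <- r | P i) F i) <= \sum_(i <- r | P i) normc (F i).
Proof.
elim/big_ind2: _ => //; first by rewrite Normc.normc0.
by move=> a b c d ab cd; apply: le_trans (le_normcD _ _) _; exact: lerD.
Qed.

Lemma normc_prod (I : Type) (r : seq I) (P : pred I) (F : I -> R[i]) :
  normc (\prod_(i <- r | P i) F i) = \prod_(i <- r | P i) normc (F i).
Proof. by elim/big_rec2: _ => [|i x y _ <-]; rewrite ?Normc.normc1// Normc.normcM. Qed.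

Lemma normc_real x : normc x%:C = `|x|.
Proof. by rewrite /= expr0n addr0 sqrtr_sqr. Qed.

Lemma normc_distC z w : normc (z - w) = normc (w - z).
Proof. by rewrite -opprB normcN. Qed.

Lemma ler_normcB (x y z : R[i]) : normc (x - z) <= normc (x - y) + normc (y - z).
Proof. by rewrite (_ : x - z = (x - y) + (y - z)); [exact: le_normcD|ring]. Qed.

Lemma Re_le_normc z : `|complex.Re z| <= normc z.
Proof. by rewrite -lecR -normr_normc normc_ge_Re. Qed.

Lemma Im_le_normc z : `|complex.Im z| <= normc z.
Proof.
rewrite -(@ler_pXn2r _ 2)// ?nnegrE ?normc_ge0// normc_sqr real_normK ?num_real//.
by rewrite lerDr sqr_ge0.
Qed.

Lemma unit_neq0 z : normc z = 1 -> z != 0.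
Proof.
move=> z1; apply/eqP => z0; move: z1; rewrite z0 Normc.normc0 => /esym/eqP.
by rewrite oner_eq0.
Qed.

Lemma normc_expz z (n : int) : normc z = 1 -> normc (z ^ n) = 1.
Proof.
by case: n => n z1; rewrite /exprz ?Normc.normcV normcX z1 expr1n ?invr1.
Qed.

Lemma unit_inv z : normc z = 1 -> z^-1 = z^*.
Proof. by move=> /normr_eq1 z1; rewrite invc_norm z1 expr1n invr1 mul1r. Qed.

Lemma expiD x y : expi (x + y) = expi x * expi y :> R[i].
Proof.
rewrite /expi cosD sinD; apply/eqP; rewrite eq_complex/=.
by apply/andP; split; apply/eqP; ring.
Qed.

Lemma expi0 : expi 0 = 1 :> R[i].
Proof. by rewrite /expi cos0 sin0. Qed.

Lemma normc_expi x : normc (expi x) = 1.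
Proof. by rewrite /= cos2Dsin2 sqrtr1. Qed.

Lemma expi_nat x n : expi (x * n%:R) = expi x ^+ n :> R[i].
Proof.
elim: n => [|n IH]; first by rewrite mulr0 expi0 expr0.
by rewrite -natr1 mulrDr mulr1 expiD IH exprSr.
Qed.

Lemma expiN x : expi (- x) = (expi x)^-1 :> R[i].
Proof.
have h : expi x * expi (- x) = 1 :> R[i] by rewrite -expiD subrr expi0.
by apply: (mulfI (unit_neq0 (normc_expi x))); rewrite h mulfV// unit_neq0// normc_expi.
Qed.

Lemma expi_int x (n : int) : expi (x * n%:~R) = expi x ^ n :> R[i].
Proof.
case: n => n; first exact: expi_nat.
by rewrite NegzE mulrNz mulrN expiN expi_nat /exprz.
Qed.

Lemma expi_sum (I : Type) (r : seq I) (P : pred I) (F : I -> R) :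
  expi (\sum_(i <- r | P i) F i) = \prod_(i <- r | P i) expi (F i) :> R[i].
Proof. by elim/big_rec2: _ => [|i x y _ <-]; rewrite ?expi0 ?expiD. Qed.

Lemma expi_2pi : expi (2 * pi) = 1 :> R[i].
Proof. by rewrite /expi mulr_natl cos2pi sin2pi. Qed.

Lemma expi_2pi_int (n : int) : expi (2 * pi * n%:~R) = 1 :> R[i].
Proof. by rewrite expi_int expi_2pi exp1rz. Qed.

(** Reducing [x] modulo [2 * pi] by a floor leaves some [t] in [[0, 2 * pi[]
  with [1 - cos t = 2 * sin (t / 2) ^+ 2], and [sin] is positive on the open
  half period. *)
Lemma expi_eq1 x : expi x = 1 :> R[i] -> exists n : int, x = 2 * pi * n%:~R.
Proof.
move=> ex1; have p0 := pi2_gt0 R; pose n := Num.floor (x / (2 * pi)).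
pose t := x - 2 * pi * n%:~R; exists n.
have et : expi t = 1 :> R[i] by rewrite /t expiD ex1 mul1r expiN expi_2pi_int invr1.
have t0 : 0 <= t.
  by rewrite subr_ge0 mulrC -ler_pdivlMr// floor_le_tmp.
have t1 : t < 2 * pi.
  have : x / (2 * pi) < (n + 1)%:~R by rewrite lt_succ_floor.
  by rewrite ltr_pdivrMr// intrD mulrDl mul1r [_ * (2 * pi)]mulrC addrC -ltrBlDr.
suff : t = 0 by move=> /eqP; rewrite subr_eq0 => /eqP.
apply/eqP; rewrite eq_le t0 andbT leNgt; apply/negP => tgt0.
have s0 : 0 < sin (t / 2) by apply: sin_gt0_pi; apply/andP; split; lra.
have : cos t = 1 by case: et.
have -> : t = (t / 2) *+ 2 by rewrite -mulr_natr divfK.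
rewrite cos_mulr2n cos2sin2 => h.
have : sin (t / 2) ^+ 2 = 0 by lra.
by move=> /eqP; rewrite sqrf_eq0 => /eqP s00; rewrite s00 ltxx in s0.
Qed.

Lemma expi_surj z : normc z = 1 -> exists2 t, 0 <= t <= 2 * pi & z = expi t.
Proof.
case: z => a b z1; have ab : a ^+ 2 + b ^+ 2 = 1.
  by have := normc_sqr (a +i* b); rewrite z1 expr1n.
have a1 : -1 <= a <= 1.
  rewrite -ler_norml -(@ler_pXn2r _ 2)// ?nnegrE// expr1n.
  by rewrite real_normK ?num_real// -ab lerDl sqr_ge0.
have ac0 := acos_ge0 a1; have acp := acos_lepi a1.
have ca : cos (acos a) = a by rewrite acosK// in_itv.
have sa : sin (acos a) = `|b|.
  by rewrite sin_acos// -ab [X in X - _]addrC addrK sqrtr_sqr.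
have [b0|b0] := lerP 0 b.
  exists (acos a); first by apply/andP; split => //; lra.
  by rewrite /expi ca sa ger0_norm.
exists (2 * pi - acos a); first by apply/andP; split; lra.
rewrite expiD expi_2pi mul1r.
by rewrite /expi cosN sinN ca sa ltr0_norm// opprK.
Qed.

(** The law of cosines: the bracket is the cosine of the angle between [z] and
  [w]. *)
Lemma normc_unitB z w : normc z = 1 -> normc w = 1 ->
  normc (z - w) ^+ 2 =
  2 - 2 * (complex.Re z * complex.Re w + complex.Im z * complex.Im w).
Proof.
move=> z1 w1; have := normc_sqr z; have := normc_sqr w; rewrite z1 w1 expr1n.
case: z {z1} => a b; case: w {w1} => c e /= h1 h2.
rewrite sqr_sqrtr ?addr_ge0 ?sqr_ge0//.
by rewrite !sqrrD !sqrrN; lra.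
Qed.

End UnitCircle.

(** * Functions on the torus *)

Section TorusFunctions.
Variables (R : realType) (m : nat).
Implicit Types (z w : 'I_m -> R[i]) (phi psi : ('I_m -> R[i]) -> R).
Implicit Types (h : {ffun 'I_m -> int}) (s : seq (R[i] * {ffun 'I_m -> int})).

Lemma torusP z : torus z <-> forall k, normc (z k) = 1.
Proof. by split=> Tz k; apply/normr_eq1/Tz. Qed.

(** Real polynomials in the real and imaginary parts of the coordinates. *)
Inductive polyfun : (('I_m -> R[i]) -> R) -> Prop :=
| polyfun_cst (c : R) : polyfun (fun=> c)
| polyfun_Re k : polyfun (fun z => complex.Re (z k))
| polyfun_Im k : polyfun (fun z => complex.Im (z k))
| polyfun_add phi psi :
    polyfun phi -> polyfun psi -> polyfun (fun z => phi z + psi z)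
| polyfun_mul phi psi :
    polyfun phi -> polyfun psi -> polyfun (fun z => phi z * psi z).

(** Piecewise polynomial functions: the closure of the polynomials under the
  operations that build minima and cut-off functions. Without products of
  non-polynomial factors, errors of approximation only add up and scale. *)
Inductive plfun : (('I_m -> R[i]) -> R) -> Prop :=
| plfun_poly phi : polyfun phi -> plfun phi
| plfun_add phi psi : plfun phi -> plfun psi -> plfun (fun z => phi z + psi z)
| plfun_scale (c : R) phi : plfun phi -> plfun (fun z => c * phi z)
| plfun_abs phi : plfun phi -> plfun (fun z => `|phi z|).

Lemma plfun_cst (c : R) : plfun (fun=> c).
Proof. exact/plfun_poly/polyfun_cst. Qed.

Lemma plfunN phi : plfun phi -> plfun (fun z => - phi z).
Proof.
move=> p; have -> : (fun z => - phi z) = (fun z => -1 * phi z).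
  by apply/funext => z; rewrite mulN1r.
exact: plfun_scale.
Qed.

Lemma polyfun_bounded phi : polyfun phi ->
  exists2 C : R, 0 < C & forall z, torus z -> `|phi z| <= C.
Proof.
elim=> {phi} [c|k|k|phi psi _ [C C0 hC] _ [C' C0' hC']
             |phi psi _ [C C0 hC] _ [C' C0' hC']].
- by exists (`|c| + 1) => [|z _]; rewrite ?ltr_wpDl ?lerDl.
- by exists 1 => // z /torusP Tz; rewrite -(Tz k) Re_le_normc.
- by exists 1 => // z /torusP Tz; rewrite -(Tz k) Im_le_normc.
- exists (C + C') => [|z Tz]; first exact: addr_gt0.
  by apply: le_trans (ler_normD _ _) _; rewrite lerD ?hC ?hC'.
- exists (C * C') => [|z Tz]; first exact: mulr_gt0.
  by rewrite normrM ler_pM ?hC ?hC'.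
Qed.

Definition unif_cont phi := forall e : R, 0 < e -> exists2 n : R, 0 < n &
  forall z w, torus z -> torus w -> (forall k, normc (z k - w k) <= n) ->
  `|phi z - phi w| <= e.

Lemma unif_cont_add phi psi : unif_cont phi -> unif_cont psi ->
  unif_cont (fun z => phi z + psi z).
Proof.
move=> u v e e0; have e2 : 0 < e / 2 by rewrite divr_gt0.
have [n1 n10 h1] := u _ e2; have [n2 n20 h2] := v _ e2.
exists (Num.min n1 n2) => [|z w Tz Tw zw]; first by rewrite lt_min n10.
have a1 : `|phi z - phi w| <= e / 2.
  by apply: h1 => // k; apply: le_trans (zw k) _; rewrite ge_min lexx.
have a2 : `|psi z - psi w| <= e / 2.
  by apply: h2 => // k; apply: le_trans (zw k) _; rewrite ge_min lexx orbT.
rewrite (_ : _ - _ = (phi z - phi w) + (psi z - psi w)); last by ring.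
by apply: le_trans (ler_normD _ _) _; lra.
Qed.

Lemma unif_cont_mul phi psi : polyfun phi -> polyfun psi ->
  unif_cont phi -> unif_cont psi -> unif_cont (fun z => phi z * psi z).
Proof.
move=> /polyfun_bounded[C C0 hC] /polyfun_bounded[D D0 hD] u v e e0.
have [|n1 n10 h1] := u (e / (2 * D)); first by rewrite divr_gt0 ?mulr_gt0.
have [|n2 n20 h2] := v (e / (2 * C)); first by rewrite divr_gt0 ?mulr_gt0.
exists (Num.min n1 n2) => [|z w Tz Tw zw]; first by rewrite lt_min n10.
have a1 : `|phi z - phi w| <= e / (2 * D).
  by apply: h1 => // k; apply: le_trans (zw k) _; rewrite ge_min lexx.
have a2 : `|psi z - psi w| <= e / (2 * C).
  by apply: h2 => // k; apply: le_trans (zw k) _; rewrite ge_min lexx orbT.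
rewrite (_ : _ - _ = (phi z - phi w) * psi z + phi w * (psi z - psi w)); last by ring.
apply: le_trans (ler_normD _ _) _; rewrite !normrM.
have b1 : `|phi z - phi w| * `|psi z| <= e / (2 * D) * D by rewrite ler_pM ?hD.
have b2 : `|phi w| * `|psi z - psi w| <= C * (e / (2 * C)) by rewrite ler_pM ?hC.
apply: le_trans (lerD b1 b2) _.
rewrite (_ : _ + _ = e)//; field; apply/andP; split; exact: lt0r_neq0.
Qed.

Lemma plfun_unif_cont phi : plfun phi -> unif_cont phi.
Proof.
elim=> {phi} [phi|phi psi _ u _ v|c phi _ u|phi _ u]; last 3 first.
- exact: unif_cont_add.
- move=> e e0; have [|n n0 hn] := u (e / (`|c| + 1)).
    by rewrite divr_gt0// ltr_wpDl.
  exists n => // z w Tz Tw zw; rewrite -mulrBr normrM.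
  have c1 : 0 < `|c| + 1 by rewrite ltr_wpDl.
  apply: le_trans (_ : (`|c| + 1) * (e / (`|c| + 1)) <= _).
    by rewrite ler_pM// ?lerDl// hn.
  by rewrite mulrC divfK// lt0r_neq0.
- move=> e e0; have [n n0 hn] := u e e0; exists n => // z w Tz Tw zw.
  by apply: le_trans (ler_dist_dist _ _) _; exact: hn.
elim=> {phi} [c|k|k|phi psi _ u _ v|phi psi p u q v].
- by move=> e e0; exists 1 => // z w _ _ _; rewrite subrr normr0 ltW.
- move=> e e0; exists e => // z w _ _ /(_ k); apply: le_trans.
  by rewrite -raddfB Re_le_normc.
- move=> e e0; exists e => // z w _ _ /(_ k); apply: le_trans.
  by rewrite -raddfB Im_le_normc.
- exact: unif_cont_add.
- exact: unif_cont_mul.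
Qed.

(** * Trigonometric polynomials *)

Definition chi h z : R[i] := \prod_k z k ^ h k.

Definition trigsum s z : R[i] := \sum_(x <- s) x.1 * chi x.2 z.

Definition trig phi :=
  exists s, forall z, torus z -> (phi z)%:C = trigsum s z.

Lemma normc_chi h z : torus z -> normc (chi h z) = 1.
Proof. by move=> /torusP Tz; rewrite /chi normc_prod big1// => k _; exact: normc_expz. Qed.

Lemma chi0 z : chi 0 z = 1.
Proof. by rewrite /chi big1// => k _; rewrite ffunE expr0z. Qed.

Lemma chiD h h' z : torus z -> chi (h + h') z = chi h z * chi h' z.
Proof.
move=> /torusP Tz; rewrite /chi -big_split; apply: eq_bigr => k _ /=.
by rewrite ffunE expfzDr// unit_neq0.
Qed.

Lemma trigsum_cat s s' z : trigsum (s ++ s') z = trigsum s z + trigsum s' z.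
Proof. exact: big_cat. Qed.

Lemma trig_cst c : trig (fun=> c).
Proof. by exists [:: (c%:C, 0)] => z _; rewrite /trigsum big_seq1 chi0 mulr1. Qed.

Definition axis (k : 'I_m) (n : int) : {ffun 'I_m -> int} :=
  [ffun j => if j == k then n else 0].

Lemma chi_axis k n z : chi (axis k n) z = z k ^ n.
Proof.
rewrite /chi (bigD1 k)//= ffunE eqxx big1 ?mulr1// => j jk.
by rewrite ffunE (negbTE jk) expr0z.
Qed.

Lemma trig_Re k : trig (fun z => complex.Re (z k)).
Proof.
exists [:: (2^-1, axis k 1); (2^-1, axis k (-1))] => z /torusP Tz.
rewrite /trigsum big_cons big_seq1/= !chi_axis expr1z exprN1 (unit_inv (Tz k)).
by rewrite -mulrDr addcJ mulrA mulVf ?mul1r// pnatr_eq0.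
Qed.

Lemma trig_Im k : trig (fun z => complex.Im (z k)).
Proof.
exists [:: (- 'i%C / 2, axis k 1); ('i%C / 2, axis k (-1))] => z /torusP Tz.
rewrite /trigsum big_cons big_seq1/= !chi_axis expr1z exprN1 (unit_inv (Tz k)).
rewrite !mulNr addrC -mulrBr ImJ_sub; ring.
Qed.

Lemma trig_add phi psi : trig phi -> trig psi -> trig (fun z => phi z + psi z).
Proof.
move=> [s hs] [s' hs']; exists (s ++ s') => z Tz.
by rewrite trigsum_cat -hs// -hs'// rmorphD.
Qed.

Lemma trig_mul phi psi : trig phi -> trig psi -> trig (fun z => phi z * psi z).
Proof.
move=> [s hs] [s' hs'].
exists [seq (x.1 * y.1, x.2 + y.2) | x <- s, y <- s'] => z Tz.
rewrite rmorphM/= hs// hs'// /trigsum big_allpairs_dep/= big_distrlr/=.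
by apply: eq_bigr => x _; apply: eq_bigr => y _; rewrite /= chiD// mulrACA.
Qed.

Lemma trig_polyfun phi : polyfun phi -> trig phi.
Proof.
by elim=> *; [exact: trig_cst|exact: trig_Re|exact: trig_Im
             |exact: trig_add|exact: trig_mul].
Qed.

Lemma trig_bounded phi : trig phi ->
  exists2 C : R, 0 < C & forall z, torus z -> `|phi z| <= C.
Proof.
move=> [s hs]; exists (\sum_(x <- s) normc x.1 + 1) => [|z Tz].
  by rewrite ltr_wpDl// sumr_ge0// => x _; exact: normc_ge0.
rewrite -normc_real hs//; apply: le_trans (normc_sum _ _ _) _.
rewrite (eq_bigr (fun x => normc x.1)) ?lerDl//.
by move=> x _; rewrite Normc.normcM normc_chi ?mulr1.
Qed.

End TorusFunctions.

(** * Uniform approximation by trigonometric polynomials *)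

Section AbsApprox.
Variable R : realType.
Implicit Types x : R.

(** The classical proof of the Weierstrass theorem for the absolute value: the
  square root of [x ^+ 2] is approximated by Newton steps of fixed slope. *)
Fixpoint abs_poly (n : nat) x : R :=
  if n is k.+1 then abs_poly k x + (x ^+ 2 - abs_poly k x ^+ 2) / 2 else 0.

Lemma bernoulli_inv (y : R) n : 0 <= y <= 1 -> (1 + n%:R * y) * (1 - y) ^+ n <= 1.
Proof.
move=> /andP[y0 y1]; elim: n => [|n IH]; first by rewrite mul0r addr0 mul1r expr0.
apply: le_trans IH; rewrite exprS mulrA ler_wpM2r ?exprn_ge0 ?subr_ge0//.
rewrite -natr1; have : 0 <= n%:R :> R by []; nra.
Qed.

(** [|x| - p' = (|x| - p) * (1 - (|x| + p) / 2)] for consecutive iterates [p]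
  and [p']. *)
Lemma abs_poly_bounds n x : `|x| <= 1 ->
  [/\ 0 <= abs_poly n x, abs_poly n x <= `|x|
    & `|x| - abs_poly n x <= `|x| * (1 - `|x| / 2) ^+ n].
Proof.
move=> x1; have x0 := normr_ge0 x; have xx := real_normK (num_real x).
elim: n => [|n [a b c]] /=; first by rewrite subr0 expr0 mulr1.
set p := abs_poly n x in a b c *; rewrite -xx.
have e : `|x| - (p + (`|x| ^+ 2 - p ^+ 2) / 2) =
  (`|x| - p) * (1 - (`|x| + p) / 2) by field.
have f : 0 <= 1 - (`|x| + p) / 2 by lra.
split; first by nra.
  by rewrite -subr_ge0 e mulr_ge0// subr_ge0.
rewrite e exprSr mulrA ler_pM// ?subr_ge0//; lra.
Qed.

Lemma abs_poly_approx n x : `|x| <= 1 -> `| `|x| - abs_poly n.+1 x| <= 2 / n.+1%:R.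
Proof.
move=> x1; have [a b c] := abs_poly_bounds n.+1 x1.
rewrite ger0_norm ?subr_ge0//; apply: le_trans c _.
have x0 := normr_ge0 x.
have h : 0 <= `|x| / 2 <= 1 by apply/andP; split; lra.
have := bernoulli_inv n.+1 h; rewrite ler_pdivlMr ?ltr0n//.
have : 0 <= (1 - `|x| / 2) ^+ n.+1 by rewrite exprn_ge0//; lra.
set E := _ ^+ _; set N := _%:R; nra.
Qed.

End AbsApprox.

Section PlfunApprox.
Variables (R : realType) (m : nat).
Implicit Types (z : 'I_m -> R[i]) (phi psi : ('I_m -> R[i]) -> R).

Lemma trig_abs_poly phi n : trig phi -> trig (fun z => abs_poly n (phi z)).
Proof.
move=> t; elim: n => [|n IH] /=; first exact: trig_cst.
apply: trig_add => //.
rewrite (_ : (fun z => _) =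
  (fun z => (phi z * phi z + (-1) * (abs_poly n (phi z) * abs_poly n (phi z))) * 2^-1)).
  apply: trig_mul (trig_cst _ _); apply: trig_add; first exact: trig_mul.
  by apply: trig_mul (trig_cst _ _) _; exact: trig_mul.
by apply/funext => z; rewrite -!expr2 mulN1r.
Qed.

Lemma plfun_approx phi : plfun phi -> forall e : R, 0 < e ->
  exists2 psi, trig psi & forall z, torus z -> `|phi z - psi z| <= e.
Proof.
elim=> {phi} [phi p|phi phi' _ h _ h'|c phi _ h|phi _ h] e e0.
- exists phi; first exact: trig_polyfun.
  by move=> z _; rewrite subrr normr0 ltW.
- have e2 : 0 < e / 2 by rewrite divr_gt0.
  have [psi t hp] := h _ e2; have [psi' t' hp'] := h' _ e2.
  exists (fun z => psi z + psi' z); first exact: trig_add.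
  move=> z Tz; have := hp _ Tz; have := hp' _ Tz.
  rewrite (_ : _ + _ - _ = (phi z - psi z) + (phi' z - psi' z)); last by ring.
  by move=> a b; apply: le_trans (ler_normD _ _) _; lra.
- have c1 : 0 < `|c| + 1 by rewrite ltr_wpDl.
  have [|psi t hp] := h (e / (`|c| + 1)); first by rewrite divr_gt0.
  exists (fun z => c * psi z); first exact: trig_mul (trig_cst _ _) _.
  move=> z Tz; rewrite -mulrBr normrM.
  apply: le_trans (_ : (`|c| + 1) * (e / (`|c| + 1)) <= _).
    by rewrite ler_pM// ?lerDl// hp.
  by rewrite mulrC divfK// lt0r_neq0.
have e2 : 0 < e / 2 by rewrite divr_gt0.
have [psi t hp] := h _ e2; have [C C0 hC] := trig_bounded t.
have [n hn] : exists n, 2 / n.+1%:R <= e / 2 / C.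
  have [|n] := @ltr_add_invr R 0 (e / 2 / C / 2); first by rewrite !divr_gt0.
  by rewrite add0r => hn; exists n; rewrite mulrC -ler_pdivlMr// ltW.
exists (fun z => C * abs_poly n.+1 (C^-1 * psi z)).
  apply: trig_mul (trig_cst _ _) _; apply: trig_abs_poly.
  exact: trig_mul (trig_cst _ _) _.
move=> z Tz; have C00 := lt0r_neq0 C0.
rewrite (_ : _ - _ = (`|phi z| - `|psi z|) +
  C * (`|C^-1 * psi z| - abs_poly n.+1 (C^-1 * psi z))); last first.
  by rewrite normrM gtr0_norm ?invr_gt0//; field.
apply: le_trans (ler_normD _ _) _.
have a : `| `|phi z| - `|psi z| | <= e / 2.
  by apply: le_trans (ler_dist_dist _ _) _; exact: hp.
have b : `|C^-1 * psi z| <= 1.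
  by rewrite normrM gtr0_norm ?invr_gt0// mulrC ler_pdivrMr// mul1r hC.
have := le_trans (abs_poly_approx n b) hn; rewrite ler_pdivlMr// mulrC => d.
rewrite [X in _ + X]normrM (gtr0_norm C0).
by apply: le_trans (lerD a d) _; lra.
Qed.

End PlfunApprox.

(** * Equidistribution of finite families of points of the torus *)

Section Equidistribution.
Variables (R : realType) (m : nat).
Implicit Types (phi psi : ('I_m -> R[i]) -> R) (h : {ffun 'I_m -> int}).
Implicit Types (I : nat -> finType).

Definition avg (J : finType) (y : J -> 'I_m -> R[i]) phi : R :=
  (\sum_j phi (y j)) / #|J|%:R.

(** Weyl's criterion is taken as the definition. The index types may depend on
  [n] arbitrarily, so that initial segments of an orbit and grids of growing
  order are instances of the same notion. *)
Definition equidistributed I (y : forall n, I n -> 'I_m -> R[i]) : Prop :=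
  [/\ forall n, (0 < #|I n|)%N, forall n i, torus (y n i)
    & forall h, h != 0 -> forall e : R, 0 < e -> \forall n \near \oo,
        normc (\sum_i chi h (y n i)) <= e * #|I n|%:R].

Lemma sum_trigsum_near (s : seq (R[i] * {ffun 'I_m -> int})) : exists c : R[i],
  forall I (y : forall n, I n -> 'I_m -> R[i]), equidistributed y ->
  forall e : R, 0 < e -> \forall n \near \oo,
  normc (\sum_i trigsum s (y n i) - c * #|I n|%:R) <= e * #|I n|%:R.
Proof.
elim: s => [|[a h] s [c hc]].
  exists 0 => I y _ e e0; near=> n.
  rewrite mul0r subr0 big1 => [|i _]; last by rewrite /trigsum big_nil.
  by rewrite Normc.normc0 mulr_ge0// ltW.
have E I (y : forall n, I n -> 'I_m -> R[i]) n :
    \sum_i trigsum ((a, h) :: s) (y n i) =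
    a * \sum_i chi h (y n i) + \sum_i trigsum s (y n i).
  rewrite mulr_sumr -big_split/=; apply: eq_bigr => i _.
  by rewrite /trigsum big_cons.
have [h0|h0] := eqVneq h 0.
  exists (a + c) => I y ey e e0; near=> n.
  have -> : \sum_i trigsum ((a, h) :: s) (y n i) - (a + c) * #|I n|%:R =
            \sum_i trigsum s (y n i) - c * #|I n|%:R.
    rewrite E h0 (eq_bigr (fun=> 1)) => [|i _]; last exact: chi0.
    by rewrite sumr_const; ring.
  by near: n; exact: hc.
exists c => I y ey e e0; have [_ _ /(_ h h0) eh] := ey.
have a1 : 0 < normc a + 1 by rewrite ltr_wpDl ?normc_ge0.
near=> n.
rewrite E -addrA; apply: le_trans (le_normcD _ _) _.
rewrite (_ : e = e / 2 + e / 2); last by rewrite -splitr.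
rewrite mulrDl lerD//; last by near: n; apply: hc => //; rewrite divr_gt0.
have : normc (\sum_i chi h (y n i)) <= e / 2 / (normc a + 1) * #|I n|%:R.
  by near: n; apply: eh; rewrite !divr_gt0.
have := normc_ge0 a; set A := normc a; set N := #|I n|%:R.
rewrite Normc.normcM -/A; set B := normc _ => A0 hB.
have : (A + 1) * B <= e / 2 * N.
  by move: hB; rewrite mulrAC ler_pdivlMr// mulrC.
have : 0 <= B by exact: normc_ge0.
by nra.
Unshelve. all: by end_near. Qed.

Lemma avgB (J : finType) (y : J -> 'I_m -> R[i]) phi psi (e : R) : (0 < #|J|)%N ->
  (forall j, `|phi (y j) - psi (y j)| <= e) -> `|avg y phi - avg y psi| <= e.
Proof.
move=> J0 h; rewrite /avg -mulrBl -sumrB normrM normfV normr_nat.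
rewrite ler_pdivrMr ?ltr0n//; apply: le_trans (ler_norm_sum _ _ _) _.
by apply: le_trans (ler_sum _ (fun j _ => h j)) _; rewrite sumr_const mulr_natr.
Qed.

(** The number [c] is the constant term of a trigonometric polynomial uniformly
  close to [phi], every other term of which averages to [0]. It is the same for
  all equidistributed families, which makes their averages comparable. *)
Lemma avg_near phi : plfun phi -> forall e : R, 0 < e -> exists c : R,
  forall I (y : forall n, I n -> 'I_m -> R[i]), equidistributed y ->
  \forall n \near \oo, `|avg (y n) phi - c| <= e.
Proof.
move=> p e e0; have e2 : 0 < e / 2 by rewrite divr_gt0.
have [psi [s hs] hpsi] := plfun_approx p e2.
have [c hc] := sum_trigsum_near s; exists (complex.Re c) => I y ey.
have [I0 Ty _] := ey; near=> n.
apply: le_trans (ler_distD (avg (y n) psi) _ _) _; rewrite (splitr e) lerD//.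
  by apply: avgB => // j; exact: hpsi.
have N0 : 0 < #|I n|%:R :> R by rewrite ltr0n.
rewrite -(ler_pM2r N0).
have -> : `|avg (y n) psi - complex.Re c| * #|I n|%:R =
    `|complex.Re (\sum_i trigsum s (y n i) - c * #|I n|%:R)|.
  rewrite -[X in _ * X]ger0_norm ?ltW// -normrM mulrBl divfK ?lt0r_neq0//.
  congr `| _ |; rewrite raddfB raddf_sum/=; congr (_ - _).
    by apply: eq_bigr => i _; rewrite -hs.
  by rewrite mulr_natr raddfMn/= mulr_natr.
by apply: le_trans (Re_le_normc _) _; near: n; exact: hc.
Unshelve. all: by end_near. Qed.

(** * Orbits, grids and rotations *)

Definition orbit_point (theta : 'I_m -> R) (x : R) : 'I_m -> R[i] :=
  fun k => expi (theta k * x).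

Lemma torus_orbit_point theta x : torus (orbit_point theta x).
Proof. by apply/torusP => k; exact: normc_expi. Qed.

Lemma chi_orbit_point h theta x :
  chi h (orbit_point theta x) = expi ((\sum_k (h k)%:~R * theta k) * x).
Proof.
rewrite mulr_suml expi_sum; apply: eq_bigr => k _.
by rewrite -expi_int mulrC mulrA.
Qed.

(** The sums of a nontrivial character along the orbit are geometric sums of a
  fixed ratio [w != 1], hence bounded. *)
Lemma equidistributed_orbit (theta : 'I_m -> R) :
  (forall h, h != 0 -> expi (\sum_k (h k)%:~R * theta k) != 1 :> R[i]) ->
  equidistributed (fun n (i : 'I_n.+1) => orbit_point theta i%:R).
Proof.
move=> free; split=> [n|n i|h h0 e e0]; [by rewrite card_ord|exact: torus_orbit_point|].
have w1 := free h h0; set w := expi _ in w1.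
pose B := normc (w - 1).
have B0 : 0 < B.
  rewrite lt_neqAle normc_ge0 andbT eq_sym; apply: contra w1.
  by move=> /eqP/Normc.eq0_normc/eqP; rewrite subr_eq0.
near=> n; rewrite card_ord (eq_bigr (fun i : 'I_n.+1 => w ^+ i)); last first.
  by move=> i _; rewrite chi_orbit_point expi_nat.
rewrite -(ler_pM2l B0) -Normc.normcM -subrX1.
apply: le_trans (_ : 2 <= _).
  apply: le_trans (le_normcD _ _) _; rewrite normcN normcX normc_expi expr1n.
  by rewrite Normc.normc1.
rewrite mulrA -ler_pdivrMl ?mulr_gt0//; apply: (@le_trans _ _ n%:R).
  by near: n; exact: nbhs_infty_ger.
by rewrite ler_nat.
Unshelve. all: by end_near. Qed.

(** With centres at odd multiples of [pi / n.+1] no arc contains [1] in its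
  interior, where the parameter of [expi] jumps from [2 * pi] to [0]. *)
Definition arc_center (n j : nat) : R[i] := expi ((2 * j + 1)%:R * (pi / n.+1%:R)).

Definition grid_point n (l : {ffun 'I_m -> 'I_n.+1}) : 'I_m -> R[i] :=
  fun k => arc_center n (l k).

(** A nontrivial character is a product of powers of roots of unity over the
  grid, and its sum vanishes once the order of the grid exceeds an exponent. *)
Lemma equidistributed_grid : equidistributed grid_point.
Proof.
split=> [n|n l|h h0 e e0].
- by rewrite card_ffun !card_ord expn_gt0.
- by apply/torusP => k; exact: normc_expi.
have [k hk] : exists k, h k != 0.
  apply/existsP; apply: contraR h0; rewrite negb_exists => /forallP h0.
  by apply/eqP/ffunP => k; rewrite ffunE; apply/eqP; rewrite -[_ == _]negbK.
near=> n.
suff -> : \sum_i chi h (@grid_point n i) = 0 :> R[i].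
  by rewrite Normc.normc0 mulr_ge0// ltW.
transitivity (\prod_k \sum_(j < n.+1) arc_center n j ^ h k).
  by rewrite bigA_distr_bigA.
rewrite (bigD1 k)//=; apply/eqP; rewrite mulf_eq0; apply/orP; left; apply/eqP.
pose w : R[i] := expi (2 * pi * (h k)%:~R / n.+1%:R).
pose u : R[i] := expi (pi / n.+1%:R * (h k)%:~R).
rewrite (eq_bigr (fun i : 'I_n.+1 => u * w ^+ i)); last first.
  move=> j _; rewrite /arc_center -expi_int -expi_nat -expiD; congr expi.
  by rewrite natrD natrM; ring.
have n0 : n.+1%:R != 0 :> R by rewrite pnatr_eq0.
have wn : w ^+ n.+1 = 1.
  by rewrite -expi_nat divfK// expi_2pi_int.
rewrite -mulr_sumr; apply/eqP; rewrite mulf_eq0; apply/orP; right.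
have : (w - 1) * (\sum_(i < n.+1) w ^+ i) = 0 by rewrite -subrX1 wn subrr.
move=> /eqP; rewrite mulf_eq0 => /orP[|//]; rewrite subr_eq0 => /eqP.
move=> /expi_eq1[q]; rewrite -mulrA => /(mulfI (lt0r_neq0 (pi2_gt0 R))).
move=> /(congr1 (fun x => x * n.+1%:R)); rewrite divfK// -[n.+1%:R]/(n.+1%:~R).
rewrite -intrM => /intr_inj hq; exfalso.
have : (`|h k| < n.+1)%N by rewrite ltnS; near: n; exact: nbhs_infty_ge.
rewrite hq abszM /=; case: (absz q =P 0%N) => [/eqP|/eqP].
  by rewrite absz_eq0 => /eqP q0; rewrite hq q0 mul0r eqxx in hk.
by rewrite -lt0n => q0; rewrite ltnNge -{1}[n.+1]mul1n leq_mul2r q0 orbT.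
Unshelve. all: by end_near. Qed.

Lemma equidistributed_rot (t : 'I_m -> R[i]) I (y : forall n, I n -> 'I_m -> R[i]) :
  torus t -> equidistributed y ->
  equidistributed (fun n i k => t k * y n i k).
Proof.
move=> Tt [I0 Ty ey]; split=> // [n i|h h0 e e0].
  move: Tt (Ty n i) => /torusP Tt /torusP Tz.
  by apply/torusP => k; rewrite Normc.normcM Tt Tz mulr1.
apply: filterS (ey h h0 e e0) => n; apply: le_trans.
rewrite (eq_bigr (fun i => chi h t * chi h (y n i))); last first.
  by move=> i _; rewrite /chi -big_split; apply: eq_bigr => k _; rewrite expfzMl.
by rewrite -mulr_sumr Normc.normcM normc_chi// mul1r.
Qed.

End Equidistribution.

(** * Comparison of a probability with averages over a grid *)

Lemma measurable_Re (R : realType) : measurable_fun setT (@complex.Re R : R[i] -> R).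
Proof.
move=> _ B mB; rewrite setTI; exists (fst @^-1` B); last by rewrite setTI.
by rewrite -[X in measurable X]setTI; exact: measurable_fst.
Qed.

Lemma measurable_Im (R : realType) : measurable_fun setT (@complex.Im R : R[i] -> R).
Proof.
move=> _ B mB; rewrite setTI; exists (snd @^-1` B); last by rewrite setTI.
by rewrite -[X in measurable X]setTI; exact: measurable_snd.
Qed.

Lemma measurable_plfun (R : realType) (d : measure_display) (T : measurableType d)
    (m : nat) (Y : 'I_m -> T -> R[i]) (phi : ('I_m -> R[i]) -> R) :
  (forall k, measurable_fun setT (Y k)) -> plfun phi ->
  measurable_fun setT (fun w => phi (Y ^~ w)).
Proof.
move=> mY; elim=> {phi} [phi|phi psi _ a _ b|c phi _ a|phi _ a].
- elim=> {phi} [c|k|k|phi psi _ a _ b|phi psi _ a _ b].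
  + exact: measurable_cst.
  + by apply: measurableT_comp (mY k); exact: measurable_Re.
  + by apply: measurableT_comp (mY k); exact: measurable_Im.
  + exact: measurable_funD.
  + exact: measurable_funM.
- exact: measurable_funD.
- exact: measurable_funM (measurable_cst _) a.
- by apply: measurableT_comp a; exact: normr_measurable.
Qed.

Section Arcs.
Variable R : realType.

Lemma cos_le_mono (x y : R) : `|x| <= y -> y <= pi -> cos y <= cos x.
Proof.
move=> xy yp; rewrite -(cos_norm x); have x0 := normr_ge0 x.
move: xy; rewrite le_eqVlt => /predU1P[->//|xy].
apply: ltW; rewrite ltr_cos// in_itv/= ?x0 ?(ltW (lt_le_trans xy yp))//.
by rewrite yp andbT ltW// (le_lt_trans x0 xy).
Qed.

(** The closed arc of half-width [pi / n.+1] around the [j]-th centre is cut out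
  of the circle by a half-plane. *)
Definition circle_arc (n j : nat) : set R[i] := [set z |
  cos (pi / n.+1%:R) <= complex.Re z * complex.Re (arc_center R n j)
                      + complex.Im z * complex.Im (arc_center R n j)].

Lemma measurable_circle_arc n j : measurable (circle_arc n j).
Proof.
rewrite -[circle_arc n j]setTI.
have := @measurable_fun_ler _ R[i] R setT (cst (cos (pi / n.+1%:R)))
  (fun z => complex.Re z * complex.Re (arc_center R n j)
          + complex.Im z * complex.Im (arc_center R n j)).
move=> /(_ (measurable_cst _)) h.
have /h /(_ measurableT [set true]) : measurable_fun setT
  (fun z : R[i] => complex.Re z * complex.Re (arc_center R n j)
          + complex.Im z * complex.Im (arc_center R n j)).
  apply: measurable_funD; apply: measurable_funM (measurable_cst _).
    exact: measurable_Re.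
  exact: measurable_Im.
exact.
Qed.

Lemma arc_expi n j (t : R) : circle_arc n j (expi t) =
  (cos (pi / n.+1%:R) <= cos (t - (2 * j + 1)%:R * (pi / n.+1%:R))) :> Prop.
Proof. by rewrite /circle_arc /= cosB. Qed.

Lemma nat_cell n (x : R) : 0 <= x <= n.+1%:R ->
  exists j : 'I_n.+1, j%:R <= x <= j%:R + 1.
Proof.
elim: n => [|n IH] /andP[x0 x1]; first by exists ord0; rewrite x0 add0r.
have [xn|xn] := lerP x n.+1%:R.
  have [|j hj] := IH; first by rewrite x0.
  by exists (widen_ord (leqnSn _) j).
by exists ord_max; rewrite ltW//= natr1.
Qed.

Lemma arc_cover n (z : R[i]) : normc z = 1 -> exists j : 'I_n.+1, circle_arc n j z.
Proof.
move=> /expi_surj[t /andP[t0 t1] ->].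
have p0 := pi_gt0 R; have N0 : 0 < n.+1%:R :> R by [].
have u0 : 0 < pi / n.+1%:R :> R by rewrite divr_gt0.
have Nu : n.+1%:R * (pi / n.+1%:R) = pi :> R by rewrite mulrC divfK// lt0r_neq0.
have [|j] := @nat_cell n (t / (2 * (pi / n.+1%:R))).
  apply/andP; split; first by rewrite divr_ge0// mulr_ge0// ltW.
  by rewrite ler_pdivrMr ?mulr_gt0// mulrCA Nu.
rewrite ler_pdivlMr ?mulr_gt0// ler_pdivrMr ?mulr_gt0// => /andP[h1 h2].
exists j; rewrite arc_expi; apply: cos_le_mono.
  rewrite natrD natrM ler_norml; apply/andP.
  by move: h1 h2; set u := pi / _; split; lra.
by rewrite ler_pdivrMr// -{1}[pi]mulr1 ler_wpM2l ?ler1n// ltW.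
Qed.

(** The half-plane of the arc puts [z] at distance at most
  [sqrt (2 - 2 * cos (pi / n.+1))] from its centre. *)
Lemma arc_close (e : R) : 0 < e -> \forall n \near \oo, forall j (z : R[i]),
  normc z = 1 -> circle_arc n j z -> normc (z - arc_center R n j) <= e.
Proof.
move=> e0.
have : (fun n => cos (pi * n.+1%:R^-1 : R)) @ \oo --> cos (pi * 0 : R).
  apply: continuous_cvg; first exact: continuous_cos.
  by apply: cvgM; [exact: cvg_cst|exact: cvg_harmonic].
rewrite mulr0 cos0 => /cvgrPdist_le/(_ (e ^+ 2 / 2)) [|N _ hN].
  by rewrite divr_gt0// exprn_gt0.
exists N => // n /hN; rewrite ger0_norm ?subr_ge0 ?cos_le1// => h j z z1 az.
rewrite -(@ler_pXn2r _ 2)// ?nnegrE ?normc_ge0 ?(ltW e0)//.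
rewrite normc_unitB//; last exact: normc_expi.
have {}az : cos (pi * n.+1%:R^-1) <= complex.Re z * complex.Re (arc_center R n j)
  + complex.Im z * complex.Im (arc_center R n j) := az.
by lra.
Qed.

(** Inside [[0, 2 * pi]] the preimage of an arc by [expi] is an interval of
  length [2 * pi / n.+1] together with at most the two endpoints. *)
Lemma uniform_arc n (j : 'I_n.+1) :
  (uniform_prob (pi2_gt0 R) (@expi R @^-1` circle_arc n j) <= (n.+1%:R^-1)%:E)%E.
Proof.
set u := pi / n.+1%:R : R; set c : R := (2 * j + 1)%:R * u.
have p0 := pi_gt0 R; have N0 : 0 < n.+1%:R :> R by [].
have u0 : 0 < u by rewrite divr_gt0.
have Nu : n.+1%:R * u = pi :> R by rewrite mulrC divfK// lt0r_neq0.
have jN : j%:R + 1 <= n.+1%:R :> R by rewrite natr1 ler_nat ltn_ord.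
have cE : c = 2 * (j%:R * u) + u by rewrite /c natrD natrM; ring.
have ju : j%:R * u + u <= pi.
  by rewrite -Nu -{2}[u]mul1r -mulrDl ler_wpM2r// ltW.
have j0 : 0 <= j%:R * u by rewrite mulr_ge0// ltW.
have mU : measurable (@expi R @^-1` circle_arc n j).
  have -> : @expi R @^-1` circle_arc n j = [set t | cos u <= cos (t - c)].
    by apply/seteqP; split=> t /=; rewrite arc_expi.
  rewrite -[X in measurable X]setTI.
  have := @measurable_fun_ler _ R R setT (cst (cos u)) (fun t => cos (t - c)).
  move=> /(_ (measurable_cst _)) h.
  have /h /(_ measurableT [set true]) : measurable_fun setT (fun t : R => cos (t - c)).
    apply: (measurableT_comp (continuous_measurable_fun (@continuous_cos R))).
    exact: (measurable_funB (@measurable_id _ _ setT) (measurable_cst c)).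
  exact.
pose J : set R := `[c - u, c + u] `|` ([set 0] `|` [set 2 * pi]).
have mJ : measurable J by apply: measurableU => //; apply: measurableU.
have sub : (@expi R @^-1` circle_arc n j) `&` `[0, 2 * pi] `<=` J.
  move=> t /= [h]; rewrite in_itv/= => /andP[t0 t1].
  have [->|tn0] := eqVneq t 0; first by right; left.
  have [->|tn1] := eqVneq t (2 * pi); first by right; right.
  have {t0 tn0}t0 : 0 < t by rewrite lt_neqAle eq_sym tn0.
  have {t1 tn1}t1 : t < 2 * pi by rewrite lt_neqAle tn1.
  left; rewrite /= in_itv/=; move: h; rewrite arc_expi -/u -/c => h.
  suff : `|t - c| <= u by rewrite ler_norml => /andP[]; lra.
  rewrite leNgt; apply/negP => ut.
  have : cos (t - c) < cos u; last by rewrite ltNge h.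
  have xlt : `|t - c| < 2 * pi - u by rewrite ltr_norml; apply/andP; split; lra.
  rewrite -cos_norm; set x := `|t - c| in ut xlt *.
  have [xp|xp] := lerP x pi.
    by rewrite ltr_cos// in_itv/=; apply/andP; split; lra.
  have -> : cos x = cos (2 * pi - x).
    by rewrite -[RHS]cosN opprB mulr_natl -[RHS]cosD2pi subrK.
  by rewrite ltr_cos// ?in_itv/=; first lra; apply/andP; split; lra.
rewrite /uniform_prob integral_uniform_pdf.
apply: (@le_trans _ _ (\int[lebesgue_measure]_(x in J) (uniform_pdf 0 (2 * pi) x)%:E)%E).
  apply: ge0_subset_integral => //.
  - exact: measurableI.
  - by apply/measurable_EFinP/measurable_funTS; exact: measurable_uniform_pdf.
  - by move=> x _; rewrite lee_fin uniform_pdf_ge0// pi2_gt0.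
apply: (@le_trans _ _ (\int[lebesgue_measure]_(x in J) ((2 * pi)^-1)%:E)%E).
  apply: ge0_le_integral => //.
  - by move=> x _; rewrite lee_fin uniform_pdf_ge0// pi2_gt0.
  - by apply/measurable_EFinP/measurable_funTS; exact: measurable_uniform_pdf.
  - move=> x _; rewrite lee_fin /uniform_pdf; case: ifP => _; rewrite ?subr0//.
    by rewrite invr_ge0 ltW// pi2_gt0.
rewrite integral_cst//.
have JE : (lebesgue_measure J <= (2 * u)%:E)%E.
  pose a : \bar R := lebesgue_measure (`[c - u, c + u]%classic : set R).
  pose b : \bar R := lebesgue_measure ([set 0] `|` [set 2 * pi] : set R).
  have b0 : b = 0%E.
    by apply: countable_lebesgue_measure0; apply: finite_set_countable; rewrite finite_setU.
  apply: (@le_trans _ _ (a + b)%E); first by apply: measureU2 => //; exact: measurableU.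
  rewrite b0 adde0 /a lebesgue_measure_itv/= lte_fin ifT; last by lra.
  by rewrite -EFinB lee_fin; lra.
apply: le_trans (lee_wpmul2l _ JE) _.
  by rewrite lee_fin invr_ge0 ltW// pi2_gt0.
have E (p q : R) : p != 0 -> q != 0 -> (2 * p)^-1 * (2 * (p / q)) = q^-1.
  by move=> p1 q1; field; rewrite p1 q1.
by rewrite -EFinM lee_fin /u E// lt0r_neq0.
Qed.

End Arcs.

Section Clamp.
Variable R : realType.

(** A continuous cut-off: [0] for [x <= 0], [x] in between, [1] for [1 <= x],
  written with absolute values so that it preserves [plfun]. *)
Definition clamp (x : R) := (1 + `|x| - `|x - 1|) / 2.

Lemma clamp_bounds x : 0 <= clamp x <= 1.
Proof.
rewrite /clamp; case: (ger0P x) => x0; case: (ger0P (x - 1)) => x1;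
  apply/andP; split; lra.
Qed.

Lemma clamp_ge1 x : 1 <= x -> clamp x = 1.
Proof. by move=> x1; rewrite /clamp !ger0_norm; lra. Qed.

Lemma clamp_le0 x : x <= 0 -> clamp x = 0.
Proof. by move=> x0; rewrite /clamp !ler0_norm; lra. Qed.

Lemma plfun_clamp m (a b : R) (h : ('I_m -> R[i]) -> R) :
  plfun h -> plfun (fun z => clamp (a * h z + b)).
Proof.
move=> ph.
have -> : (fun z => clamp (a * h z + b)) = (fun z => 2^-1 *
    ((1 + `|a * h z + b|) + -1 * `|a * h z + (b - 1)|)).
  by apply/funext => z; rewrite /clamp mulrC mulN1r addrA.
apply: plfun_scale; apply: plfun_add; first apply: plfun_add (plfun_cst _ _) _.
  apply: plfun_abs; apply: plfun_add (plfun_cst _ _); exact: plfun_scale.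
apply: plfun_scale; apply: plfun_abs; apply: plfun_add (plfun_cst _ _).
exact: plfun_scale.
Qed.

End Clamp.

Lemma avg_le (R : realType) m (J : finType) (y : J -> 'I_m -> R[i])
    (phi psi : ('I_m -> R[i]) -> R) :
  (forall j, phi (y j) <= psi (y j)) -> avg y phi <= avg y psi.
Proof. by move=> h; rewrite /avg ler_wpM2r ?invr_ge0// ler_sum. Qed.

Lemma fsbig_finType (R : realType) (I : finType) (F : I -> \bar R) :
  (\sum_(i \in [set: I]) F i = \sum_i F i)%E.
Proof.
rewrite fsbig_finite//=; apply: perm_big.
apply: uniq_perm; [exact: fset_uniq|exact: index_enum_uniq|move=> i].
rewrite in_fset_set; last exact: finite_finset.
by rewrite mem_set//; apply/esym; exact: mem_index_enum.
Qed.

Section TorusVariable.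
Variables (R : realType) (dO : measure_display) (Omega : measurableType dO).
Variables (P : probability Omega R) (m : nat) (Y : 'I_m -> {RV P >-> R[i]}).
Hypothesis Y_unif : forall k, uniform_on_circle (Y k).
Hypothesis Y_indep : independent_RVs Y.

Local Notation Yw := (fun w k => Y k w).

Lemma torus_Y w : torus (Yw w).
Proof. by move=> k; have [] := Y_unif k. Qed.

(** The event is covered by the cells of the grid that it meets, and a cell, a
  product of [m] arcs, has probability at most [n.+1 ^- m]. *)
Lemma prob_le_avg_grid n (B : set Omega) (phi : ('I_m -> R[i]) -> R) :
  measurable B -> (forall z, 0 <= phi z) ->
  (forall w (l : {ffun 'I_m -> 'I_n.+1}), B w ->
     (forall k, circle_arc n (l k) (Y k w)) -> 1 <= phi (grid_point R l)) ->
  (P B <= (avg (@grid_point R m n) phi)%:E)%E.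
Proof.
move=> mB phi0 hB.
pose cell (l : {ffun 'I_m -> 'I_n.+1}) : set Omega :=
  \bigcap_(k in [set: 'I_m]) (Y k @^-1` circle_arc n (l k)).
pose A l := if `[< exists2 w, B w & cell l w >] then cell l else set0.
have mcell l : measurable (cell l).
  apply: fin_bigcap_measurable => // k _.
  rewrite -[X in measurable X]setTI; apply: measurable_funPT => //.
  exact: measurable_circle_arc.
have mA l : measurable (A l) by rewrite /A; case: ifP.
have BA : B `<=` \bigcup_(l in [set: {ffun 'I_m -> 'I_n.+1}]) A l.
  move=> w Bw.
  have /choice[l hl] k : exists j : 'I_n.+1, circle_arc n j (Y k w).
    by apply: arc_cover; apply/normr_eq1; exact: torus_Y.
  have cl : cell [ffun k => l k] w by move=> k _; rewrite /= ffunE.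
  exists [ffun k => l k] => //; rewrite /A ifT//.
  by apply/asboolP; exists w.
have := @content_sub_fsum _ _ _ P _ setT B A finite_finset (fun l _ => mA l) mB BA.
rewrite fsbig_finType /= => /le_trans; apply.
rewrite /avg card_ffun !card_ord natrX mulrC mulr_sumr -sumEFin.
apply: lee_sum => l _; rewrite /A; case: ifP => [/asboolP[w Bw cw]|_]; last first.
  by rewrite measure0 lee_fin mulr_ge0// invr_ge0 exprn_ge0.
apply: (@le_trans _ _ ((n.+1%:R ^+ m)^-1)%:E); last first.
  rewrite lee_fin ler_peMr ?invr_ge0 ?exprn_ge0// (hB w)//.
  by move=> k; exact: cw.
rewrite Y_indep; last by move=> k; exact: measurable_circle_arc.
rewrite -exprVn -[X in _ ^+ X](card_ord m) -prodr_const.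
pose K (x : \bar R) (r : R) := (0 <= x)%E /\ (x <= r%:E)%E.
suff : K (\prod_(k < m) P (Y k @^-1` circle_arc n (l k)))%E (\prod_(k < m) n.+1%:R^-1).
  by case.
apply: (big_ind2 K) => [|x r x' r' [x0 xr] [x'0 x'r]|k _].
- by split; rewrite ?lee_fin.
- by split; [exact: mule_ge0|rewrite EFinM lee_pmul].
- split=> //; have [_ hd] := Y_unif k.
  by rewrite -[leLHS]/(distribution P (Y k) _) hd ?uniform_arc//; exact: measurable_circle_arc.
Qed.

Lemma cell_close h : plfun h -> forall e : R, 0 < e -> \forall n \near \oo,
  forall w (l : {ffun 'I_m -> 'I_n.+1}), (forall k, circle_arc n (l k) (Y k w)) ->
  `|h (Yw w) - h (grid_point R l)| <= e.
Proof.
move=> ph e e0; have [r r0 hr] := plfun_unif_cont ph e0.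
have := arc_close r0; apply: filterS => n hn w l wl; apply: hr.
- exact: torus_Y.
- by apply/torusP => k; exact: normc_expi.
- by move=> k; apply: hn; [apply/normr_eq1; exact: torus_Y|exact: wl].
Qed.

Lemma measurable_gt (h : ('I_m -> R[i]) -> R) (c : R) : plfun h ->
  measurable [set w | c < h (Yw w)].
Proof.
move=> ph; have mh : measurable_fun setT (fun w => h (Yw w)).
  exact: (@measurable_plfun _ _ _ _ (fun k => Y k)).
have := measurable_fun_ltr (measurable_cst c) mh => /(_ measurableT [set true]).
by rewrite setTI; exact.
Qed.

Lemma measurable_zero (h : ('I_m -> R[i]) -> R) : plfun h ->
  measurable [set w | h (Yw w) = 0].
Proof.
move=> ph; have -> : [set w | h (Yw w) = 0] = ~` [set w | 0 < `|h (Yw w)|].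
  apply/seteqP; split=> w /=; first by move=> ->; rewrite normr0 ltxx.
  by rewrite normr_gt0 => /negP; rewrite negbK => /eqP.
by apply: measurableC; apply: measurable_gt (plfun_abs _).
Qed.

(** Continuity of [P] from below, along the events [h > 1 / n.+1]. *)
Lemma prob_gt_inner h : plfun h -> forall e : R, 0 < e -> exists2 r : R, 0 < r &
  (P [set w | 0 < h (Yw w)]%R <= P [set w | r < h (Yw w)]%R + e%:E)%E.
Proof.
move=> ph e e0; pose F n := [set w | n.+1%:R^-1 < h (Yw w)].
have FU : \bigcup_n F n = [set w | 0 < h (Yw w)].
  apply/seteqP; split=> [w [n _]|w] /=; first by apply: le_lt_trans; rewrite invr_ge0.
  by move=> /ltr_add_invr[k]; rewrite add0r => hk; exists k.
have mF n : measurable (F n) by exact: measurable_gt.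
have ndF : nondecreasing_seq F.
  apply/nondecreasing_seqP => n; apply/subsetPset => w /=; apply: le_lt_trans.
  by rewrite lef_pV2 ?posrE// ler_nat.
have := @nondecreasing_cvg_mu _ _ _ P F mF; rewrite FU.
move=> /(_ (measurable_gt 0 ph) ndF).
set p := P [set w | 0 < _].
have pfin : p \is a fin_num by rewrite fin_num_measure//; exact: measurable_gt.
move=> cv; have pe : (p - e%:E < p)%E by rewrite lteBlDr// lteDl// lte_fin.
have [n hn] : exists n, (p - e%:E < P (F n))%E.
  apply: contrapT => /forallNP hn; move: pe; apply/negP; rewrite -leNgt.
  rewrite -[leLHS](cvg_lim (@ereal_hausdorff R) cv).
  apply: lime_le; first by apply/cvg_ex; exists p.
  by near=> n; rewrite leNgt; apply/negP; exact: hn.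
exists n.+1%:R^-1; first by rewrite invr_gt0.
by rewrite -leeBlDr// ltW.
Unshelve. all: by end_near. Qed.

(** Let [3 * r] be the threshold of [prob_gt_inner]. The function
  [clamp (h / r - 1)] is [1] where [h >= 2 * r], hence at the centres of the
  cells met by [h > 3 * r] when the grid is fine, and [0] where [h <= r]. Its
  averages over the grid, above [P (h Y > 3 * r)], and over the family [y], below
  the frequency of [h > r], are asymptotically equal. *)
Lemma weyl_lower_bound h : plfun h -> forall e : R, 0 < e ->
  exists2 r : R, 0 < r & forall (I : nat -> finType) (y : forall n, I n -> 'I_m -> R[i]),
  equidistributed y -> \forall n \near \oo,
  (P [set w | 0 < h (Yw w)]%R <=
   (avg (y n) (fun z => (r < h z)%R%:R) + e)%:E)%E.
Proof.
move=> ph e e0; have e3 : 0 < e / 3 by rewrite divr_gt0.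
have [r3 r30 hr] := prob_gt_inner ph e3.
pose r := r3 / 3; have r0 : 0 < r by rewrite divr_gt0.
pose phi z := clamp (r^-1 * h z + -1).
have pphi : plfun phi by exact: plfun_clamp.
have phi1 z : 2 * r <= h z -> phi z = 1.
  move=> hz; apply: clamp_ge1; suff : 2 <= r^-1 * h z by lra.
  by rewrite mulrC ler_pdivlMr.
have phi0 z : h z <= r -> phi z = 0.
  move=> hz; apply: clamp_le0; suff : r^-1 * h z <= 1 by lra.
  by rewrite mulrC ler_pdivrMr// mul1r.
have [c hc] := avg_near pphi e3.
exists r => // I y ey.
have [N gridN PN] : exists2 N, `|avg (@grid_point R m N) phi - c| <= e / 3 &
    (P [set w | r3 < h (Yw w)]%R <= (avg (@grid_point R m N) phi)%:E)%E.
  near \oo => N; exists N; first by near: N; exact: hc (equidistributed_grid R m).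
  apply: prob_le_avg_grid; first exact: measurable_gt.
    by move=> z; have /andP[] := clamp_bounds (r^-1 * h z + -1).
  move=> w l hw lw; rewrite phi1//.
  have : `|h (Yw w) - h (grid_point R l)| <= r.
    by move: w l lw {hw}; near: N; exact: cell_close.
  by rewrite ler_norml => /andP[_]; move: hw; rewrite /= /r; lra.
near=> n.
have yn : `|avg (y n) phi - c| <= e / 3 by near: n; exact: hc.
have le : avg (y n) phi <= avg (y n) (fun z => (r < h z)%R%:R).
  apply: avg_le => j; case: ltP => hj; last by rewrite phi0.
  by have /andP[] := clamp_bounds (r^-1 * h (y n j) + -1).
apply: le_trans hr _; apply: le_trans (leeD2r _ PN) _.
rewrite -EFinD lee_fin.
by move: gridN yn; rewrite !ler_norml => /andP[_ a] /andP[b _]; lra.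
Unshelve. all: by end_near. Qed.

End TorusVariable.
(** * Zero sets of trigonometric polynomials *)

Lemma seq_argmax (T : eqType) (f : T -> nat) (s : seq T) : s != [::] ->
  exists2 x, x \in s & forall y, y \in s -> (f y <= f x)%N.
Proof.
elim: s => // a [|b s] IH _; first by exists a; rewrite ?inE// => y; rewrite inE => /eqP ->.
have [//|x xs hx] := IH; have [ax|/ltnW xa] := leqP (f a) (f x).
  by exists x => [|y]; rewrite in_cons ?xs ?orbT// => /predU1P[->//|/hx].
exists a; rewrite ?mem_head// => y; rewrite in_cons => /predU1P[->//|/hx yx].
exact: leq_trans yx xa.
Qed.

(** The monomial curve [k |-> x ^ k] leaves every hyperplane: a nonzero vector
  [h] is the coefficient vector of a nonzero polynomial in [x]. *)
Lemma separating_vector m (L : seq {ffun 'I_m -> int}) :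
  (forall h, h \in L -> h != 0) ->
  exists v : 'I_m -> int, forall h, h \in L -> \sum_k h k * v k != 0.
Proof.
move=> L0; pose p (h : {ffun 'I_m -> int}) : {poly int} := \sum_k h k *: 'X^k.
have p0 h : h \in L -> p h != 0.
  move=> /L0; apply: contraNN => /eqP ph; apply/eqP/ffunP => k; rewrite ffunE.
  have : (p h)`_k = 0 by rewrite ph coef0.
  rewrite /p coef_sum (bigD1 k)//= coefZ coefXn eqxx mulr1 big1 ?addr0//.
  move=> j jk; rewrite coefZ coefXn (_ : _ == _ = false) ?mulr0//.
  by apply/negbTE; rewrite eq_sym; apply: contra jk => /eqP/ord_inj ->.
pose q := \prod_(h <- L) p h.
have q0 : q != 0.
  rewrite /q; elim: L p0 {L0 q} => [|h L IH] p0; first by rewrite big_nil oner_neq0.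
  rewrite big_cons mulf_neq0 ?p0 ?mem_head//.
  by apply: IH => g gL; rewrite p0// inE gL orbT.
have [x qx] : exists x : nat, ~~ root q x%:Z.
  apply: contrapT => /forallNP all_roots.
  pose rs := [seq (i%:Z : int) | i <- iota 0 (size q)].
  have : (size rs < size q)%N.
    apply: max_poly_roots => //.
      by apply/allP => _ /mapP[i _ ->]; apply/negPn/negP; exact: all_roots.
    by rewrite map_inj_uniq ?iota_uniq// => i j [].
  by rewrite size_map size_iota ltnn.
exists (fun k => x%:Z ^+ k) => h hL.
have : ~~ root (p h) x%:Z.
  apply: contra qx; rewrite /q /root horner_prod => /eqP h0.
  by rewrite (big_rem h)//= h0 mul0r.
rewrite /root /p horner_sum; congr (_ != _); apply: eq_bigr => k _.
by rewrite hornerZ hornerXn.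
Qed.

Section NormalForm.
Variables (R : realType) (m : nat).
Implicit Types (s : seq (R[i] * {ffun 'I_m -> int})) (z : 'I_m -> R[i]).

(** Terms with equal exponents are collected and zero coefficients dropped. *)
Lemma trigsum_normal_form s : exists (H : seq {ffun 'I_m -> int})
    (a : {ffun 'I_m -> int} -> R[i]),
  [/\ uniq H, forall h, h \in H -> a h != 0
    & forall z, trigsum s z = \sum_(h <- H) a h * chi h z].
Proof.
pose a h := \sum_(x <- s | x.2 == h) x.1.
pose U := undup [seq x.2 | x <- s].
exists [seq h <- U | a h != 0], a; split.
- by rewrite filter_uniq// undup_uniq.
- by move=> h; rewrite mem_filter => /andP[].
move=> z; rewrite big_filter; transitivity (\sum_(h <- U) a h * chi h z); last first.
  rewrite [in LHS](bigID (fun h => a h != 0))/= [X in _ + X]big1 ?addr0// => h.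
  by rewrite negbK => /eqP ->; rewrite mul0r.
rewrite (eq_bigr (fun h => \sum_(x <- s | x.2 == h) x.1 * chi x.2 z)); last first.
  by move=> h _; rewrite mulr_suml; apply: eq_bigr => x /eqP ->.
rewrite (exchange_big_dep predT)//= /trigsum; apply: eq_big_seq => x xs.
have xU : x.2 \in U by rewrite mem_undup; apply: map_f.
rewrite -big_filter (_ : [seq h <- U | x.2 == h] = [:: x.2]) ?big_seq1//.
have := @filter_pred1_uniq _ U x.2 (undup_uniq _) xU; rewrite /pred1.
by move=> <-; apply: eq_filter => h /=; rewrite eq_sym.
Qed.

(** The one-parameter subgroup [t |-> (t ^ v_k)_k]. *)
Definition subgroup_point (v : 'I_m -> int) (t : R[i]) : 'I_m -> R[i] :=
  fun k => t ^ v k.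

Lemma torus_subgroup_point v t : normc t = 1 -> torus (subgroup_point v t).
Proof. by move=> t1; apply/torusP => k; exact: normc_expz. Qed.

Lemma chi_subgroup_point h v t z : normc t = 1 ->
  chi h (fun k => subgroup_point v t k * z k) = t ^ (\sum_k h k * v k) * chi h z.
Proof.
move=> t1; rewrite /chi; have -> : t ^ (\sum_k h k * v k) = \prod_k t ^ (h k * v k).
  elim/big_rec2: _ => [|k x y _ <-]; first by rewrite expr0z.
  by rewrite expfzDr// unit_neq0.
rewrite -big_split; apply: eq_bigr => k _.
by rewrite expfzMl mulrC [h k * _]mulrC exprz_exp mulrC.
Qed.

(** Restricted to the translates of a one-parameter subgroup that separates its
  exponents, a nonzero trigonometric polynomial becomes, up to a unit factor, a
  polynomial in one variable whose degree and modulus of leading coefficient do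
  not depend on the translate. *)
Lemma trigsum_restrict s z0 : trigsum s z0 != 0 ->
  exists (v : 'I_m -> int) (M : nat), exists2 a : R, 0 < a &
  forall z, torus z -> exists Q : {poly R[i]},
  [/\ size Q = M.+1, normc (lead_coef Q) = a
    & forall t, normc t = 1 ->
      normc (trigsum s (fun k => subgroup_point v t k * z k)) = normc Q.[t]].
Proof.
move=> sz0; have [H [a [uH a0 sE]]] := trigsum_normal_form s.
have Hn0 : H != [::] by apply: contra sz0 => /eqP H0; rewrite sE H0 big_nil.
have [|v hv] := @separating_vector m [seq h - g | h <- H, g <- rem h H].
  move=> _ /allpairsPdep[h [g [hH gH ->]]]; rewrite subr_eq0.
  by apply/eqP => hg; move: gH; rewrite hg mem_rem_uniq// inE eqxx.
pose b (h : {ffun 'I_m -> int}) : int := \sum_k h k * v k.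
have b_inj h g : h \in H -> g \in H -> b h = b g -> h = g.
  move=> hH gH bhg; apply/eqP/negPn/negP => hg.
  have : b (h - g) != 0.
    by apply: hv; apply/allpairsPdep; exists h, g; rewrite mem_rem_uniq// inE eq_sym hg.
  suff -> : b (h - g) = b h - b g by rewrite bhg subrr eqxx.
  by rewrite /b -sumrB; apply: eq_bigr => k _; rewrite !ffunE mulrBl.
pose E : nat := \sum_(h <- H) `|b h|.
have bE h : h \in H -> 0 <= E%:Z + b h.
  move=> hH; rewrite -lerBlDr sub0r; apply: (@le_trans _ _ `|b h|%:Z).
    by rewrite -abszN; exact: lez_abs.
  by rewrite lez_nat /E (big_rem h)//= leq_addr.
pose d h := absz (E%:Z + b h).
have dE h : h \in H -> (d h)%:Z = E%:Z + b h by move=> /bE; exact: gez0_abs.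
have d_inj h g : h \in H -> g \in H -> d h = d g -> h = g.
  move=> hH gH dhg; apply: b_inj => //; apply: (addrI E%:Z).
  by rewrite -!dE// dhg.
have [hm hmH hmax] := seq_argmax d Hn0.
exists v, (d hm), (normc (a hm)).
  rewrite lt_neqAle normc_ge0 andbT eq_sym; apply: contra (a0 _ hmH).
  by move=> /eqP/Normc.eq0_normc ->.
move=> z Tz; pose Q := \sum_(h <- H) (a h * chi h z) *: 'X^(d h).
have Qm : Q`_(d hm) = a hm * chi hm z.
  rewrite /Q coef_sum (bigD1_seq hm)//= coefZ coefXn eqxx mulr1.
  rewrite big_seq_cond big1 ?addr0// => h /andP[hH hhm].
  rewrite coefZ coefXn (_ : _ == _ = false) ?mulr0//.
  by apply/negbTE; apply: contra hhm => /eqP/d_inj ->.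
have Qm0 : Q`_(d hm) != 0.
  rewrite Qm mulf_neq0 ?a0//; apply: unit_neq0; exact: normc_chi.
have sQ : size Q = (d hm).+1.
  apply/eqP; rewrite eqn_leq; apply/andP; split; last first.
    by rewrite ltnNge; apply: contra Qm0 => /(nth_default 0) ->.
  rewrite /Q big_seq; apply: (big_ind (fun q : {poly R[i]} => (size q <= (d hm).+1)%N)).
  - by rewrite size_poly0.
  - by move=> p q hp hq; apply: leq_trans (size_polyD _ _) _; rewrite geq_max hp.
  - by move=> h hH; apply: leq_trans (size_scale_leq _ _) _; rewrite size_polyXn ltnS hmax.
exists Q; split=> //.
  by rewrite lead_coefE sQ Qm Normc.normcM normc_chi// mulr1.
move=> t t1; rewrite sE.
have -> : Q.[t] = t ^+ E * \sum_(h <- H) a h * chi h (fun k => subgroup_point v t k * z k).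
  rewrite /Q horner_sum mulr_sumr; apply: eq_big_seq => h hH.
  rewrite chi_subgroup_point// hornerZ hornerXn -/(b h).
  have -> : t ^+ d h = t ^+ E * t ^ b h.
    by rewrite exprnP dE// expfzDr ?unit_neq0.
  by ring.
by rewrite Normc.normcM normcX t1 expr1n mul1r.
Qed.

End NormalForm.

Section RootCount.
Variable R : realType.

(** If [Q] is small at [t], some root of [Q] is close to [t]; roots close to
  separated points are distinct. *)
Lemma count_small_values (Q : {poly R[i]}) (M K : nat) (tau : 'I_K -> R[i]) (r : R) :
  size Q = M.+1 -> 0 < r ->
  (forall i j, i != j -> 2 * r <= normc (tau i - tau j)) ->
  (#|[set i | (normc Q.[tau i] < normc (lead_coef Q) * r ^+ M)%R]%SET| <= M)%N.
Proof.
move=> sQ r0 sep; set A := [set i | _]%SET.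
have [rs QE] : exists rs : seq R[i], Q = lead_coef Q *: \prod_(z <- rs) ('X - z%:P).
  by have [rs QE] := closed_field_poly_normal Q; exists rs.
have Q0 : Q != 0 by rewrite -size_poly_gt0 sQ.
have l0 : lead_coef Q != 0 by rewrite lead_coef_eq0.
have srs : size rs = M.
  by move: sQ; rewrite QE size_scale// size_prod_XsubC => -[].
have near_root i : i \in A -> exists2 z, z \in rs & normc (tau i - z) < r.
  rewrite inE => hi; apply: contrapT => far; move: hi; apply/negP; rewrite -leNgt.
  rewrite [in leRHS]QE hornerZ Normc.normcM ler_wpM2l ?normc_ge0//.
  have -> : r ^+ M = \prod_(z <- rs) r.
    by rewrite -srs; elim: (rs) => [|z l IH]; rewrite ?big_nil ?expr0// big_cons exprS IH.
  rewrite horner_prod normc_prod big_seq [leRHS]big_seq.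
  apply: ler_prod => z zrs; rewrite ltW//= hornerXsubC leNgt; apply/negP => hz.
  by apply: far; exists z.
have [i0|/set0Pn[i1 i1A]] := eqVneq A finset.set0; first by rewrite i0 cards0.
have [f hf] : exists f : 'I_K -> R[i],
    forall i, i \in A -> f i \in rs /\ normc (tau i - f i) < r.
  have /choice[f hf] i : exists z, i \in A -> z \in rs /\ normc (tau i - z) < r.
    have [iA|iA] := boolP (i \in A); last by exists 0.
    by have [z zrs hz] := near_root i iA; exists z.
  by exists f.
have f_inj : {in A &, injective f}.
  move=> i j iA jA fij; apply/eqP/negPn/negP => ij.
  have := sep _ _ ij; apply/negP; rewrite -ltNge.
  have [_ hi] := hf _ iA; have [_ hj] := hf _ jA.
  apply: le_lt_trans (ler_normcB _ (f i) _) _.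
  by rewrite [X in _ + X]normc_distC {2}fij; lra.
rewrite cardE -srs -(size_map f); apply: uniq_leq_size.
  by rewrite map_inj_in_uniq ?enum_uniq// => i j; rewrite !mem_enum; exact: f_inj.
by move=> _ /mapP[i iA ->]; move: iA; rewrite mem_enum => /hf[].
Qed.

(** The angles [i / K] lie in an interval shorter than a full turn. *)
Lemma separated_units K : exists2 tau : 'I_K -> R[i], forall i, normc (tau i) = 1 &
  exists2 r : R, 0 < r & forall i j, i != j -> 2 * r <= normc (tau i - tau j).
Proof.
pose tau (i : 'I_K) : R[i] := expi (i%:R / K%:R).
exists tau => [i|]; first exact: normc_expi.
have dist i j : i != j -> 0 < normc (tau i - tau j).
  move=> ij; rewrite lt_neqAle normc_ge0 andbT eq_sym; apply: contra ij.
  move=> /eqP/Normc.eq0_normc/eqP; rewrite subr_eq0 => /eqP tij.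
  have : expi (i%:R / K%:R - j%:R / K%:R) = 1 :> R[i].
    by rewrite expiD expiN -/(tau i) -/(tau j) tij mulfV// unit_neq0// normc_expi.
  move=> /expi_eq1[n hn].
  have K0 : 0 < K%:R :> R by rewrite ltr0n (leq_ltn_trans _ (ltn_ord i)).
  have lt1 (k : 'I_K) : 0 <= (k%:R / K%:R : R) < 1.
    by rewrite divr_ge0//= ltr_pdivrMr// mul1r ltr_nat ltn_ord.
  have n0 : n = 0.
    have [n1|n1|//] := ltgtP n 0.
    - exfalso; have : n%:~R <= -1 :> R by rewrite -[-1]/((-1)%:~R) ler_int -ltzD1 addNr.
      move: hn (pi_ge2 R) (lt1 i) (lt1 j); set x := _ / _; set y := j%:R / _.
      set q := n%:~R; set p := pi => hn p2 /andP[? ?] /andP[? ?] q1.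
      have : 0 <= (p - 2) * (-1 - q) by rewrite mulr_ge0//; lra.
      by lra.
    - exfalso; have : 1 <= n%:~R :> R by rewrite -[1]/(1%:~R) ler_int.
      move: hn (pi_ge2 R) (lt1 i) (lt1 j); set x := _ / _; set y := j%:R / _.
      set q := n%:~R; set p := pi => hn p2 /andP[? ?] /andP[? ?] q1.
      have : 0 <= (p - 2) * (q - 1) by rewrite mulr_ge0//; lra.
      by lra.
  move: hn; rewrite n0 mulr0 => /eqP; rewrite subr_eq0 => /eqP/divIf.
  by move=> /(_ (lt0r_neq0 K0))/eqP; rewrite eqr_nat => /eqP/ord_inj ->.
have [r r0 hr] : exists2 r : R, 0 < r & forall i j, i != j -> r < normc (tau i - tau j) / 2.
  near (0 : R)^'+ => r; exists r => //.
  near: r; apply: filter_forall => i; apply: filter_forall => j.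
  have [->|ij] := eqVneq i j; first by apply: nearW => r; case/eqP.
  have h : 0 < normc (tau i - tau j) / 2 by rewrite divr_gt0// dist.
  near=> r => _; near: r; exact: nbhs_right_lt.
by exists r => // i j /hr h; rewrite mulrC -ler_pdivlMr// ltW.
Unshelve. all: by end_near. Qed.

End RootCount.

Section NullZeroSet.
Variables (R : realType) (dO : measure_display) (Omega : measurableType dO).
Variables (P : probability Omega R) (m : nat) (Y : 'I_m -> {RV P >-> R[i]}).
Hypothesis Y_unif : forall k, uniform_on_circle (Y k).
Hypothesis Y_indep : independent_RVs Y.

(** The mean over the torus of a bump function [phi] at the zero set is invariant
  under rotations, so it is also the mean of the average of the rotates of
  [phi] by [K] points of a separating one-parameter subgroup; at each point at
  most [M] of these rotates are nonzero, [M] being independent of [K]. *)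
Lemma prob_zero_set (p : ('I_m -> R[i]) -> R) (z0 : 'I_m -> R[i]) :
  polyfun p -> torus z0 -> p z0 != 0 -> P [set w | p (fun k => Y k w) = 0] = 0%E.
Proof.
move=> pp Tz0 pz0; have [s hs] := trig_polyfun pp.
have [|v [M [a a0 hv]]] := @trigsum_restrict _ _ s z0.
  by rewrite -hs//; apply: contra pz0 => /eqP/complexI ->.
have mZ : measurable [set w | p (fun k => Y k w) = 0].
  exact: (measurable_zero Y (plfun_poly pp)).
apply/eqP; rewrite eq_le measure_ge0 andbT; apply/lee_addgt0Pr => e e0; rewrite add0e.
have e3 : 0 < e / 3 by rewrite divr_gt0.
have [K hK] : exists K : nat, M%:R / K.+1%:R <= e / 3.
  have [|k] := @ltr_add_invr R 0 (e / 3 / M.+1%:R); first by rewrite divr_gt0.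
  rewrite add0r => hk; exists k; rewrite mulrC.
  apply: (@le_trans _ _ (k.+1%:R^-1 * M.+1%:R)).
    by rewrite ler_wpM2l ?invr_ge0// ler_nat.
  by rewrite -ler_pdivlMr// ltW.
have [tau tau1 [r r0 sep]] := separated_units R K.+1.
pose delta := a * r ^+ M; have d0 : 0 < delta by rewrite mulr_gt0// exprn_gt0.
pose phi z := clamp ((- (2 / delta)) * `|p z| + 2).
have pphi : plfun phi by apply: plfun_clamp; apply: plfun_abs; exact: plfun_poly.
have phi01 z : 0 <= phi z <= 1 by exact: clamp_bounds.
have phi1 z : `|p z| <= delta / 2 -> phi z = 1.
  move=> hz; apply: clamp_ge1; suff : 2 / delta * `|p z| <= 1 by lra.
  by rewrite -invf_div mulrC ler_pdivrMr ?divr_gt0// mul1r.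
have phi0 z : delta <= `|p z| -> phi z = 0.
  move=> hz; apply: clamp_le0; suff : 2 <= 2 / delta * `|p z| by lra.
  by rewrite mulrAC ler_pdivlMr// ler_pM2l.
have few z : torus z ->
    \sum_(i < K.+1) phi (fun k => subgroup_point v (tau i) k * z k) <= M%:R.
  move=> Tz; have [Q [sQ lQ hQ]] := hv z Tz.
  have := @count_small_values _ Q M K.+1 tau r sQ r0 sep.
  set A := [set i | _]%SET; rewrite -(ler_nat R); apply: le_trans.
  rewrite -sum1_card natr_sum [leRHS]big_mkcond/=; apply: ler_sum => i _.
  case: ifPn => [_|].
    by have /andP[] := phi01 (fun k => subgroup_point v (tau i) k * z k).
  rewrite inE -leNgt lQ -hQ// -hs ?normc_real => [h|]; first by rewrite phi0.
  move/torusP : Tz => Tz; apply/torusP => k.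
  by rewrite Normc.normcM Tz mulr1 normc_expz.
have e6 : 0 < e / 6 by rewrite divr_gt0.
have [c hc] := avg_near pphi e6.
near \oo => N.
have PN : (P [set w | p (fun k => Y k w) = 0]%R <= (avg (@grid_point R m N) phi)%:E)%E.
  apply: prob_le_avg_grid => // [z|w l hw lw]; first by have /andP[] := phi01 z.
  rewrite phi1//.
  have : `|p (fun k => Y k w) - p (grid_point R l)| <= delta / 2.
    move: w l lw {hw}; near: N; apply: cell_close => //; first exact: plfun_poly.
    by rewrite divr_gt0.
  by move: hw => /= ->; rewrite sub0r normrN.
apply: le_trans PN _; rewrite lee_fin.
have gN : `|avg (@grid_point R m N) phi - c| <= e / 6.
  by near: N; exact: hc (equidistributed_grid R m).
have rotN i :
    `|avg (fun l k => subgroup_point v (tau i) k * @grid_point R m N l k) phi - c|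
      <= e / 6.
  move: i; near: N; apply: filter_forall => i.
  apply: (hc _ (fun n l k => subgroup_point v (tau i) k * @grid_point R m n l k)).
  by apply: equidistributed_rot (equidistributed_grid R m); exact: torus_subgroup_point.
have K0 : 0 < K.+1%:R :> R by [].
have sumN : \sum_(i < K.+1)
    avg (fun l k => subgroup_point v (tau i) k * @grid_point R m N l k) phi <= M%:R.
  rewrite /avg -mulr_suml exchange_big/= ler_pdivrMr; last first.
    by rewrite ltr0n card_ffun !card_ord expn_gt0.
  have Tg (l : {ffun 'I_m -> 'I_N.+1}) : torus (grid_point R l).
    by apply/torusP => k; exact: normc_expi.
  apply: le_trans (ler_sum _ (fun l _ => few _ (Tg l))) _.
  by rewrite sumr_const mulr_natr.
have : K.+1%:R * (c - e / 6) <= M%:R.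
  apply: le_trans sumN; rewrite mulr_natl -[X in _ *+ X]card_ord -sumr_const.
  by apply: ler_sum => i _; move: (rotN i); rewrite ler_norml => /andP[]; lra.
rewrite mulrC -ler_pdivlMr// => h; move: gN; rewrite ler_norml => /andP[_].
by move: (le_trans h hK); lra.
Unshelve. all: by end_near. Qed.

End NullZeroSet.

(** * Rational functions and chains of inequalities *)

Section PolynomialMaps.
Variables (R : realType) (m : nat).
Implicit Types (u v : ('I_m -> R[i]) -> R[i]).

Definition cpolyfun u :=
  polyfun (fun z => complex.Re (u z)) /\ polyfun (fun z => complex.Im (u z)).

Lemma polyfunN (phi : ('I_m -> R[i]) -> R) : polyfun phi -> polyfun (fun z => - phi z).
Proof.
move=> p; have -> : (fun z => - phi z) = (fun z => -1 * phi z).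
  by apply/funext => z; rewrite mulN1r.
by apply: polyfun_mul => //; exact: polyfun_cst.
Qed.

Lemma polyfunB (phi psi : ('I_m -> R[i]) -> R) :
  polyfun phi -> polyfun psi -> polyfun (fun z => phi z - psi z).
Proof. by move=> p q; apply: polyfun_add => //; exact: polyfunN. Qed.

Lemma cpolyfun_cst (c : R[i]) : cpolyfun (fun=> c).
Proof. by split; exact: polyfun_cst. Qed.

Lemma cpolyfun_coord k : cpolyfun (fun z => z k).
Proof. by split; [exact: polyfun_Re|exact: polyfun_Im]. Qed.

Lemma cpolyfun_add u v : cpolyfun u -> cpolyfun v -> cpolyfun (fun z => u z + v z).
Proof.
move=> [a b] [c e]; split.
  by under eq_fun do rewrite raddfD; exact: polyfun_add.
by under eq_fun do rewrite raddfD; exact: polyfun_add.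
Qed.

Lemma cpolyfun_mul u v : cpolyfun u -> cpolyfun v -> cpolyfun (fun z => u z * v z).
Proof.
move=> [a b] [c e].
have E z : u z * v z =
  (complex.Re (u z) * complex.Re (v z) - complex.Im (u z) * complex.Im (v z))
  +i* (complex.Re (u z) * complex.Im (v z) + complex.Im (u z) * complex.Re (v z)).
  by case: (u z) (v z) => [x y] [x' y'].
split; under eq_fun do rewrite E/=.
  by apply: polyfunB; exact: polyfun_mul.
by apply: polyfun_add; exact: polyfun_mul.
Qed.

Lemma cpolyfun_conj u : cpolyfun u -> cpolyfun (fun z => (u z)^*).
Proof.
move=> [a b]; have E z : (u z)^* = complex.Re (u z) -i* complex.Im (u z).
  by case: (u z).
by split; under eq_fun do rewrite E/=; [|exact: polyfunN].
Qed.

Lemma cpolyfun_exp u n : cpolyfun u -> cpolyfun (fun z => u z ^+ n).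
Proof.
move=> cu; elim: n => [|n IH]; first exact: cpolyfun_cst.
by under eq_fun do rewrite exprS; exact: cpolyfun_mul.
Qed.

Lemma cpolyfun_sum (I : Type) (r : seq I) (F : I -> ('I_m -> R[i]) -> R[i]) :
  (forall i, cpolyfun (F i)) -> cpolyfun (fun z => \sum_(i <- r) F i z).
Proof.
move=> cF; elim: r => [|i r IH].
  by under eq_fun do rewrite big_nil; exact: cpolyfun_cst.
by under eq_fun do rewrite big_cons; exact: cpolyfun_add.
Qed.

Lemma cpolyfun_prod (I : Type) (r : seq I) (F : I -> ('I_m -> R[i]) -> R[i]) :
  (forall i, cpolyfun (F i)) -> cpolyfun (fun z => \prod_(i <- r) F i z).
Proof.
move=> cF; elim: r => [|i r IH].
  by under eq_fun do rewrite big_nil; exact: cpolyfun_cst.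
by under eq_fun do rewrite big_cons; exact: cpolyfun_mul.
Qed.

Lemma cpolyfun_meval (p : mpoly m R[i]) : cpolyfun (fun z => meval z p).
Proof.
under eq_fun do rewrite mevalE.
apply: cpolyfun_sum => t; apply: cpolyfun_mul (cpolyfun_cst _) _.
by apply: cpolyfun_prod => i; exact: cpolyfun_exp (cpolyfun_coord _).
Qed.

(** A polynomial expression in [z] and its conjugate that agrees with the integer
  power [z ^ n] on the unit circle. *)
Definition unit_exp (z : R[i]) (n : int) : R[i] :=
  if n is Negz k then (z^*) ^+ k.+1 else z ^+ `|n|%N.

Lemma unit_expE (z : R[i]) n : normc z = 1 -> unit_exp z n = z ^ n.
Proof. by move=> z1; case: n => n //=; rewrite -unit_inv// exprVn. Qed.

Lemma cpolyfun_unit_exp u n : cpolyfun u -> cpolyfun (fun z => unit_exp (u z) n).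
Proof.
move=> cu; case: n => n; first exact: cpolyfun_exp.
by apply: cpolyfun_exp; exact: cpolyfun_conj.
Qed.

Lemma polyfun_comp r (phi : ('I_r -> R[i]) -> R) (u : ('I_m -> R[i]) -> 'I_r -> R[i]) :
  polyfun phi -> (forall i, cpolyfun (fun z => u z i)) -> polyfun (fun z => phi (u z)).
Proof.
move=> p cu; elim: p => {phi} [c|k|k|phi psi _ a _ b|phi psi _ a _ b].
- exact: polyfun_cst.
- by have [] := cu k.
- by have [] := cu k.
- exact: polyfun_add.
- exact: polyfun_mul.
Qed.

(** The real part of [p / q] is that of [p] times the conjugate of [q], divided
  by [|q| ^+ 2]. *)
Lemma ratfun_Re_frac (f : ratfun R m) : no_pole_on_torus f ->
  exists A B : ('I_m -> R[i]) -> R, [/\ polyfun A, polyfun B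
    & forall z, torus z -> 0 < B z /\ ratfun_Re f z = A z / B z].
Proof.
move=> [p [q [fpq q0]]].
have [pr pi] := cpolyfun_meval p; have [qr qi] := cpolyfun_meval q.
exists (fun z => complex.Re (meval z p) * complex.Re (meval z q) +
                 complex.Im (meval z p) * complex.Im (meval z q)).
exists (fun z => complex.Re (meval z q) * complex.Re (meval z q) +
                 complex.Im (meval z q) * complex.Im (meval z q)).
split; [by apply: polyfun_add; exact: polyfun_mul..|].
move=> z /q0 qz; rewrite -!expr2 -normc_sqr; split.
  rewrite exprn_gt0// lt_neqAle normc_ge0 andbT eq_sym.
  by apply: contra qz => /eqP/Normc.eq0_normc ->.
rewrite /ratfun_Re (ratfun_evalE fpq qz) normc_sqr.
case: (meval z p) => a b; case: (meval z q) => c e /=.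
by rewrite mulrN opprK !mulrA -mulrDl.
Qed.

(** * Minima of finitely many functions *)

(** The value [1] of the empty minimum is harmless, since only the sign of a
  minimum and small thresholds matter. *)
Fixpoint minfun (L : seq (('I_m -> R[i]) -> R)) (z : 'I_m -> R[i]) : R :=
  if L is phi :: L' then Num.min (phi z) (minfun L' z) else 1.

Lemma plfun_minfun L : (forall n, (n < size L)%N -> plfun (nth (fun=> 0) L n)) ->
  plfun (minfun L).
Proof.
elim: L => [|phi L IH] pL /=; first exact: plfun_cst.
have pphi : plfun phi by exact: (pL 0%N).
have {}IH : plfun (minfun L) by apply: IH => n nL; exact: (pL n.+1).
have -> : (fun z => Num.min (phi z) (minfun L z)) =
    (fun z => 2^-1 * ((phi z + minfun L z) + -1 * `|phi z + -1 * minfun L z|)).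
  by apply/funext => z; rewrite Num.Theory.minr_absE !mulN1r mulrC.
apply: plfun_scale; apply: plfun_add; first exact: plfun_add.
by apply: plfun_scale; apply: plfun_abs; apply: plfun_add => //; exact: plfun_scale.
Qed.

Lemma minfun_gt L (c : R) z : c < 1 ->
  (c < minfun L z) = all (fun phi => c < phi z) L.
Proof. by move=> c1; elim: L => //= phi L <-; rewrite lt_min. Qed.

Lemma minfun_ge L (c : R) z : c <= 1 ->
  (c <= minfun L z) = all (fun phi => c <= phi z) L.
Proof. by move=> c1; elim: L => //= phi L <-; rewrite le_min. Qed.

End PolynomialMaps.

Lemma sorted_chainP (R : realType) D (e : rel R) (x : 'I_D -> R) :
  reflect (forall j k : 'I_D, k = j.+1 :> nat -> e (x j) (x k))
          (sorted e [seq x j | j : 'I_D]).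
Proof.
case: D x => [|D] x.
  rewrite (_ : [seq x j | j : 'I_0] = [::]); first by constructor=> -[].
  by apply: size0nil; rewrite size_map size_enum_ord.
have nthE n (nD : (n < D.+1)%N) :
    nth (x ord0) [seq x j | j : 'I_D.+1] n = x (Ordinal nD).
  rewrite (nth_map ord0) ?size_enum_ord//; congr x; apply: val_inj.
  by rewrite /= nth_enum_ord.
apply: (iffP (sortedP (x ord0))) => [h j k kj|h n].
  have := h j; rewrite size_map size_enum_ord -kj ltn_ord => /(_ isT).
  rewrite (nthE _ (ltn_ord j)) (nthE _ (ltn_ord k)).
  have ordE (i : 'I_D.+1) : Ordinal (ltn_ord i) = i by exact: val_inj.
  by rewrite !ordE.
rewrite size_map size_enum_ord => nD.
by rewrite (nthE _ (ltnW nD)) (nthE _ nD); exact: h.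
Qed.

(** * Densities *)

Section LimInfSup.
Variable R : realType.
Implicit Types (u : nat -> R) (l : R).

Lemma limn_einf_ge u l :
  (forall e : R, 0 < e -> \forall n \near \oo, l <= u n + e) ->
  (l%:E <= limn_einf (fun n => (u n)%:E))%E.
Proof.
move=> h; apply/lee_addgt0Pr => e e0; rewrite -leeBlDr// limn_einf_lim.
apply: lime_ge; first exact: is_cvg_einfs.
have [N _ hN] := h e e0; near=> n.
apply: le_ereal_inf_tmp => _ [k /= nk <-]; rewrite -EFinB lee_fin lerBlDr.
by apply: hN; apply: leq_trans nk; near: n; exact: nbhs_infty_ge.
Unshelve. all: by end_near. Qed.

Lemma limn_esup_le u l :
  (forall e : R, 0 < e -> \forall n \near \oo, u n <= l + e) ->
  (limn_esup (fun n => (u n)%:E) <= l%:E)%E.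
Proof.
move=> h; rewrite -leeN2 -limn_einfN -EFinN.
apply: (@limn_einf_ge (fun n => - u n)) => e /h; apply: filterS => n; lra.
Qed.

End LimInfSup.

Lemma sum_progressions d Q (g : nat -> nat) :
  (\sum_(0 <= n < d * Q) g n = \sum_(a < d) \sum_(q < Q) g (a + d * q))%N.
Proof.
elim: Q => [|Q IH].
  by rewrite muln0 big_nil big1// => a _; rewrite big_ord0.
rewrite mulnS addnC (big_cat_nat (n := d * Q))//=; last by rewrite leq_addr.
have -> : (\sum_(d * Q <= n < d * Q + d) g n = \sum_(a < d) g (a + d * Q))%N.
  by rewrite -{1}[(d * Q)%N]add0n big_addn addKn big_mkord.
rewrite IH -big_split/=.
by apply: eq_bigr => a _; rewrite big_ord_recr.
Qed.

(** Up to boundary terms bounded by [d + 1], the integers up to [X] are the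
  disjoint union of [d] arithmetic progressions of length [X %/ d]. *)
Lemma density_progressions (R : realType) d (S : nat -> bool) (L : 'I_d -> R) :
  (0 < d)%N -> (forall a, 0 <= L a <= 1) ->
  (forall a e, 0 < e -> \forall Q \near \oo,
    L a <= (\sum_(q < Q.+1) S (a + d * q)%N)%:R / Q.+1%:R + e) ->
  forall e : R, 0 < e -> \forall X \near \oo,
    d%:R^-1 * \sum_a L a <= (count S (iota 1 X))%:R / X%:R + e.
Proof.
move=> d0 L01 hL e e0; have e2 : 0 < e / 2 by rewrite divr_gt0.
have [N hN] : exists N : nat, forall Q, (N <= Q)%N -> forall a,
    L a <= (\sum_(q < Q.+1) S (a + d * q)%N)%:R / Q.+1%:R + e / 2.
  have : \forall Q \near \oo, forall a,
      L a <= (\sum_(q < Q.+1) S (a + d * q)%N)%:R / Q.+1%:R + e / 2.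
    by apply: filter_forall => a; exact: hL.
  by move=> [N _ hN]; exists N.
have dR : 0 < d%:R :> R by rewrite ltr0n.
near=> X.
have X0 : (0 < X)%N by near: X; exact: nbhs_infty_gt.
have XR : 0 < X%:R :> R by rewrite ltr0n.
have XN : (d * N.+1 <= X)%N by near: X; exact: nbhs_infty_ge.
have [Q XQ] : exists Q, (X %/ d = Q.+1)%N.
  by exists (X %/ d).-1; rewrite prednK// divn_gt0// (leq_trans _ XN)// leq_pmulr.
have NQ : (N <= Q)%N by rewrite -ltnS -XQ leq_divRL// mulnC.
have dQX : (d * Q.+1 <= X)%N by rewrite -XQ mulnC leq_trunc_div.
have XdQ : (X <= d * Q.+1 + d)%N.
  by rewrite -XQ mulnC {1}(divn_eq X d) leq_add2l ltnW// ltn_mod.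
set c := count S _.
have c_ge : (\sum_(a < d) \sum_(q < Q.+1) S (a + d * q)%N <= c.+1)%N.
  rewrite -(sum_progressions d Q.+1 (fun n => S n)).
  have -> : c = (\sum_(1 <= n < X.+1) S n)%N.
    rewrite /c -sum1_count big_mkcond/= /index_iota subn1.
    by apply: eq_bigr => n _; case: (S n).
  apply: (@leq_trans (\sum_(0 <= n < X.+1) S n)%N).
    by rewrite [leqRHS](big_cat_nat (n := d * Q.+1))//= ?leq_addr// leqW.
  by rewrite big_ltn//; case: (S 0%N); rewrite ?add1n ?add0n ?leqnSn.
have sumL : \sum_a L a * Q.+1%:R <= (c%:R + 1) + d%:R * Q.+1%:R * (e / 2).
  apply: (@le_trans _ _ (\sum_(a < d)
      ((\sum_(q < Q.+1) S (a + d * q)%N)%:R + Q.+1%:R * (e / 2)))).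
    apply: ler_sum => a _; have := hN Q NQ a.
    by rewrite -lerBlDr ler_pdivlMr// mulrBl [e / 2 * _]mulrC lerBlDr.
  rewrite big_split/= -natr_sum sumr_const card_ord.
  rewrite -[(_ * (e / 2)) *+ _]mulr_natl mulrA lerD2r.
  by rewrite natr1 ler_nat.
have sumL0 : 0 <= \sum_a L a by apply: sumr_ge0 => a _; have /andP[] := L01 a.
have sumLd : \sum_a L a <= d%:R.
  apply: le_trans (_ : \sum_(a < d) 1 <= _); last by rewrite sumr_const card_ord.
  by apply: ler_sum => a _; have /andP[] := L01 a.
have Xbig : d%:R + 1 <= X%:R * (e / 2).
  rewrite -ler_pdivrMr//; near: X; exact: nbhs_infty_ger.
move: sumL; rewrite -mulr_suml; set T := \sum_a L a in sumL0 sumLd * => sumL.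
rewrite -(ler_pM2r XR) mulrDl divfK ?lt0r_neq0//.
have : d%:R^-1 * T * X%:R <= d%:R^-1 * T * (d%:R * Q.+1%:R + d%:R).
  rewrite ler_wpM2l// ?mulr_ge0 ?invr_ge0//.
  by rewrite -natrM -natrD ler_nat.
have -> : d%:R^-1 * T * (d%:R * Q.+1%:R + d%:R) = T * Q.+1%:R + T.
  by set q := Q.+1%:R; field; exact: lt0r_neq0.
have : d%:R * Q.+1%:R * (e / 2) <= X%:R * (e / 2).
  by rewrite ler_wpM2r ?(ltW e2)// -natrM ler_nat.
lra.
Unshelve. all: by end_near. Qed.

Section OrbitFrequency.
Variables (R : realType) (dO : measure_display) (Omega : measurableType dO).
Variables (P : probability Omega R) (m : nat) (Y : 'I_m -> {RV P >-> R[i]}).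
Hypothesis Y_unif : forall k, uniform_on_circle (Y k).
Hypothesis Y_indep : independent_RVs Y.
Variable theta : 'I_m -> R.
Hypothesis theta_free : forall h : {ffun 'I_m -> int}, h != 0 ->
  expi (\sum_k (h k)%:~R * theta k) != 1 :> R[i].

(** [S q] may fail for finitely many [q] with [h > r], which does not affect the
  limit frequency. *)
Lemma orbit_frequency (h : ('I_m -> R[i]) -> R) (S : nat -> bool) : plfun h ->
  (forall r : R, 0 < r -> \forall q \near \oo,
    r < h (orbit_point theta q%:R) -> S q) ->
  forall e : R, 0 < e -> \forall Q \near \oo,
  fine (P [set w | 0 < h (fun k => Y k w)]) <=
  (\sum_(q < Q.+1) S q)%:R / Q.+1%:R + e.
Proof.
move=> ph hS e e0; have e2 : 0 < e / 2 by rewrite divr_gt0.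
have [r r0 hr] := weyl_lower_bound Y_unif Y_indep ph e2.
have [N _ hN] := hS r r0.
have eo := equidistributed_orbit theta_free.
near=> Q.
have hQ : (P [set w | 0 < h (fun k => Y k w)]%R <=
    (avg (fun i : 'I_Q.+1 => orbit_point theta i%:R) (fun z => (r < h z)%R%:R) + e / 2)%:E)%E.
  by near: Q; exact: hr eo.
have QR : 0 < Q.+1%:R :> R by [].
have NQ : N%:R / (e / 2) <= Q.+1%:R.
  apply: (@le_trans _ _ Q%:R); last by rewrite ler_nat.
  near: Q; exact: nbhs_infty_ger.
rewrite -lee_fin fineK; last by rewrite fin_num_measure//; exact: measurable_gt.
apply: le_trans hQ _; rewrite lee_fin [X in _ <= _ + X](splitr e) addrA lerD2r.
rewrite /avg card_ord -(ler_pM2r QR) mulrDl !divfK ?lt0r_neq0//.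
apply: (@le_trans _ _ ((\sum_(q < Q.+1) S q)%:R + N%:R)); last first.
  by rewrite lerD2l mulrC -ler_pdivrMr.
have countN : (\sum_(q < Q.+1) (q < N)%N <= N)%N.
  rewrite -(big_mkord predT (fun q => nat_of_bool (q < N)%N)).
  have : (\sum_(0 <= q < Q.+1) (q < N)%N <= \sum_(0 <= q < N + Q.+1) (q < N)%N)%N.
    by rewrite [leqRHS](big_cat_nat (n := Q.+1)) ?leq_addr ?leq_addl.
  move=> /leq_trans; apply; rewrite (big_cat_nat (n := N))/= ?leq_addr//.
  rewrite [X in (_ + X)%N]big_nat_cond [X in (_ + X)%N]big1 ?addn0; last first.
    by move=> q /andP[/andP[Nq _] _]; rewrite ltnNge Nq.
  rewrite big_nat_cond (eq_bigr (fun=> 1%N)) => [|q /andP[/andP[_ ->]]]//.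
  by rewrite -big_nat_cond sum_nat_const_nat subn0 muln1.
apply: (@le_trans _ _ ((\sum_(q < Q.+1) S q)%:R + (\sum_(q < Q.+1) (q < N)%N)%:R)).
  rewrite !natr_sum -big_split/=; apply: ler_sum => q _.
  rewrite -natrD ler_nat; case: (ltP r) => // hq.
  have [Nq|qN] := leqP N q; last by rewrite addn1.
  by have -> := hN _ Nq hq.
by rewrite lerD2l ler_nat.
Unshelve. all: by end_near. Qed.

End OrbitFrequency.
(** * Orbits of the angles along arithmetic progressions *)

Section Angles.
Variables (R : realType) (m s : nat) (theta : 'I_(m + s) -> R).
Variables (c : 'I_s -> rat) (b : 'I_m -> 'I_s -> rat).
Hypothesis theta_free : Qfree (angles_basis theta).
Hypothesis theta_coords : forall j : 'I_s,
  theta (rshift m j) =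
  2 * pi * ratr (c j) + \sum_(k < m) ratr (b k j) * theta (lshift s k).

Local Notation d := (lcm_denoms c b).
Local Notation theta0 := (fun k => theta (lshift s k)).

Lemma lcm_denoms_gt0 : (0 < d)%N.
Proof.
have pos (x : rat) : (0 < `|denq x|)%N by rewrite absz_gt0 denq_eq0.
apply: (big_ind (fun n => (0 < n)%N)) => // [x y x0 y0|j _]; first by rewrite lcmn_gt0 x0.
rewrite lcmn_gt0 pos/=; apply: (big_ind (fun n => (0 < n)%N)) => // x y x0 y0.
by rewrite lcmn_gt0 x0.
Qed.

Lemma lcm_denoms_const (j : 'I_s) : exists n : int, d%:R * c j = n%:~R.
Proof.
have /dvdnP[e de] : (`|denq (c j)| %| d)%N.
  by rewrite /lcm_denoms (bigD1 j)//= (dvdn_trans _ (dvdn_lcml _ _))// dvdn_lcml.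
exists (e%:Z * numq (c j)); rewrite de natrM intrM numqE.
by rewrite -[in RHS](absz_denq (c j)); ring.
Qed.

(** A relation would give a rational dependence between [2 * pi] and the first
  [m] angles. *)
Lemma angles_character (h : {ffun 'I_m -> int}) : h != 0 ->
  expi (\sum_k (h k)%:~R * theta0 k) != 1 :> R[i].
Proof.
apply: contraNN => /eqP /expi_eq1[n hn].
pose a (o : option 'I_m) : rat := if o is Some k then (h k)%:~R else - n%:~R.
have : a =1 (fun=> 0).
  apply: theta_free; rewrite (bigD1 None)//=.
  rewrite (reindex_omap Some id)/=; last by case.
  rewrite (eq_bigl predT) => [|k]; last by rewrite /= eqxx.
  rewrite (eq_bigr (fun k => (h k)%:~R * theta0 k)) => [|k _]; last by rewrite /= ratr_int.
  by rewrite hn /= rmorphN/= ratr_int; ring.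
move=> a0; apply/eqP/ffunP => k; rewrite ffunE.
by have := a0 (Some k) => /eqP; rewrite intr_eq0 => /eqP.
Qed.

(** At the orbit point of [q] these are the [e^(i theta_i d q)], and at the
  independent uniform variables the components of [Z]. *)
Definition monomials (y : 'I_m -> R[i]) (i : 'I_(m + s)) : R[i] :=
  match fintype.split i with
  | inl k => y k ^+ d
  | inr j => \prod_k unit_exp (y k) (hcoef c b k j)
  end.

Definition translate (a : nat) (y : 'I_m -> R[i]) (i : 'I_(m + s)) : R[i] :=
  nu theta i ^+ a * monomials y i.

Lemma monomials_lshift y k : monomials y (lshift s k) = y k ^+ d.
Proof. by rewrite /monomials (unsplitK (inl k)). Qed.

Lemma monomials_rshift y j : torus y ->
  monomials y (rshift m j) = \prod_k y k ^ hcoef c b k j.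
Proof.
move=> /torusP Ty; rewrite /monomials (unsplitK (inr j)).
by apply: eq_bigr => k _; rewrite unit_expE.
Qed.

Lemma cpolyfun_translate a i : cpolyfun (fun y => translate a y i).
Proof.
apply: (@cpolyfun_mul _ _ (fun=> nu theta i ^+ a) (fun y => monomials y i)).
  exact: cpolyfun_cst.
rewrite /monomials.
case: fintype.split => [k|j].
  by apply: (@cpolyfun_exp _ _ (fun y => y k)); exact: cpolyfun_coord.
apply: cpolyfun_prod => k; apply: (@cpolyfun_unit_exp _ _ (fun y => y k)).
exact: cpolyfun_coord.
Qed.

Lemma torus_translate a y : torus y -> torus (translate a y).
Proof.
move=> Ty; apply/torusP => i; rewrite /translate Normc.normcM normcX normc_expi.
rewrite expr1n mul1r; move/torusP : (Ty) => Ty1.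
rewrite -(splitK i); case: fintype.split => [k|j] /=.
  by rewrite monomials_lshift normcX Ty1 expr1n.
by rewrite monomials_rshift// normc_prod big1// => k _; exact: normc_expz.
Qed.

(** Multiplying the angles by [d] makes their coordinates integral, and turns the
  rational multiples of [2 * pi] into integral ones. *)
Lemma orbit_translate (a : nat) (q : int) i :
  expi (theta i * (a%:R + d%:R * q%:~R)) = translate a (orbit_point theta0 q%:~R) i.
Proof.
rewrite mulrDr expiD expi_nat /translate; congr (_ * _).
rewrite -(splitK i); case: fintype.split => [k|j] /=.
  by rewrite monomials_lshift /orbit_point -expi_nat; congr expi; ring.
rewrite monomials_rshift; last exact: torus_orbit_point.
have [n hn] := lcm_denoms_const j.
have -> : theta (rshift m j) * (d%:R * q%:~R) =
  2 * pi * (n * q)%:~R + \sum_k theta0 k * q%:~R * (hcoef c b k j)%:~R.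
  have nR : n%:~R = d%:R * ratr (c j) :> R by rewrite -(ratr_int R n) -hn rmorphM/= ratr_nat.
  rewrite theta_coords mulrDl mulr_suml intrM nR; congr (_ + _); first by ring.
  apply: eq_bigr => k _.
  have -> : (hcoef c b k j)%:~R = d%:R * ratr (b k j) :> R.
    by rewrite -(ratr_int R (hcoef _ _ _ _)) hcoefE rmorphM/= ratr_nat.
  by ring.
rewrite expiD expi_2pi_int mul1r expi_sum; apply: eq_bigr => k _.
by rewrite expi_int.
Qed.

End Angles.

Section PlfunComp.
Variables (R : realType) (m r : nat).

Lemma plfun_comp (phi : ('I_r -> R[i]) -> R) (u : ('I_m -> R[i]) -> 'I_r -> R[i]) :
  plfun phi -> (forall i, cpolyfun (fun z => u z i)) -> plfun (fun z => phi (u z)).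
Proof.
move=> p cu; elim: p => {phi} [phi p|phi psi _ a _ b|k phi _ a|phi _ a].
- by apply: plfun_poly; exact: polyfun_comp.
- exact: plfun_add.
- exact: plfun_scale.
- exact: plfun_abs.
Qed.

End PlfunComp.

(** * Chains of values of rational functions *)

Lemma ratfun_Re_family (R : realType) (r D : nat) (f : 'I_D -> ratfun R r) :
  (forall j, no_pole_on_torus (f j)) -> exists A B : 'I_D -> ('I_r -> R[i]) -> R,
  [/\ forall j, polyfun (A j), forall j, polyfun (B j)
    & forall j z, torus z -> 0 < B j z /\ ratfun_Re (f j) z = A j z / B j z].
Proof.
move=> f_no_pole.
have /choice[A /choice[B AB]] j : exists A B : ('I_r -> R[i]) -> R,
    [/\ polyfun A, polyfun B
      & forall z, torus z -> 0 < B z /\ ratfun_Re (f j) z = A z / B z].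
  exact: ratfun_Re_frac.
by exists A, B; split=> j; have [] := AB j.
Qed.

Section ChainFunction.
Variables (R : realType) (r D : nat) (f : 'I_D -> ratfun R r).
Variables (A B : 'I_D -> ('I_r -> R[i]) -> R).
Hypothesis polyfun_A : forall j, polyfun (A j).
Hypothesis polyfun_B : forall j, polyfun (B j).
Hypothesis AB : forall j z, torus z -> 0 < B j z /\ ratfun_Re (f j) z = A j z / B j z.

(** The sign of [gap (j, k)] is that of [f j - f k]. *)
Definition gap (p : 'I_D * 'I_D) z : R := A p.1 z * B p.2 z - A p.2 z * B p.1 z.

Definition consecutive : seq ('I_D * 'I_D) :=
  [seq p : 'I_D * 'I_D <- enum {: 'I_D * 'I_D} | p.2 == p.1.+1 :> nat].

Definition chain_fun : ('I_r -> R[i]) -> R :=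
  minfun [seq gap p | p <- consecutive].

Lemma mem_consecutive p : (p \in consecutive) = (p.2 == p.1.+1 :> nat).
Proof. by rewrite mem_filter mem_enum andbT. Qed.

Lemma polyfun_gap p : polyfun (gap p).
Proof. by apply: polyfunB; exact: polyfun_mul. Qed.

Lemma plfun_chain_fun : plfun chain_fun.
Proof.
apply: plfun_minfun => n; rewrite size_map => nc; apply: plfun_poly.
move: nc; case: consecutive => // p l nc.
by rewrite (nth_map p)//; exact: polyfun_gap.
Qed.

Lemma gapE p z : torus z ->
  gap p z = (ratfun_Re (f p.1) z - ratfun_Re (f p.2) z) * (B p.1 z * B p.2 z).
Proof.
move=> Tz; have [B1 ->] := AB p.1 Tz; have [B2 ->] := AB p.2 Tz.
by rewrite /gap; field; rewrite !lt0r_neq0.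
Qed.

Lemma strict_chain_funE z : torus z ->
  strict_chain (fun j => ratfun_Re (f j) z) = (0 < chain_fun z).
Proof.
move=> Tz; rewrite /chain_fun minfun_gt// all_map.
have gap_gt p : (0 < gap p z) = (ratfun_Re (f p.2) z < ratfun_Re (f p.1) z).
  have [[B1 _] [B2 _]] := (AB p.1 Tz, AB p.2 Tz).
  by rewrite gapE// pmulr_lgt0 ?mulr_gt0// subr_gt0.
apply/sorted_chainP/allP => [h p|h j k kj].
  by rewrite mem_consecutive => /eqP pc; rewrite /= gap_gt; exact: h.
by have := h (j, k); rewrite mem_consecutive kj eqxx /= gap_gt; apply.
Qed.

Lemma weak_chain_funE z : torus z ->
  weak_chain (fun j => ratfun_Re (f j) z) = (0 <= chain_fun z).
Proof.
move=> Tz; rewrite /chain_fun minfun_ge// all_map.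
have gap_ge p : (0 <= gap p z) = (ratfun_Re (f p.2) z <= ratfun_Re (f p.1) z).
  have [[B1 _] [B2 _]] := (AB p.1 Tz, AB p.2 Tz).
  by rewrite gapE// pmulr_lge0 ?mulr_gt0// subr_ge0.
apply/sorted_chainP/allP => [h p|h j k kj].
  by rewrite mem_consecutive => /eqP pc; rewrite /= gap_ge; exact: h.
by have := h (j, k); rewrite mem_consecutive kj eqxx /= gap_ge; apply.
Qed.

Lemma denominators_bounded : exists2 C : R, 0 < C & forall j z, torus z -> B j z <= C.
Proof.
have /choice[C hC] j : exists C : R, 0 < C /\ forall z, torus z -> B j z <= C.
  have [C C0 hC] := polyfun_bounded (polyfun_B j); exists C; split=> // z Tz.
  exact: le_trans (ler_norm _) (hC _ Tz).
exists (\sum_j C j + 1) => [|j z Tz].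
  by rewrite ltr_wpDl// sumr_ge0// => j _; have [/ltW] := hC j.
rewrite (bigD1 j)//= -addrA; have [_ /(_ z Tz)/le_trans] := hC j; apply.
by rewrite lerDl addr_ge0// sumr_ge0// => k _; have [/ltW] := hC k.
Qed.

(** With [C] a bound of the denominators, a gap exceeding [t] separates the two
  values by at least [t / C ^+ 2], and perturbing each of them by at most half of
  this preserves their order. *)
Lemma chain_fun_stable (t : R) : 0 < t -> exists2 e : R, 0 < e &
  forall z (x : 'I_D -> R), torus z ->
  (forall j, `|x j - ratfun_Re (f j) z| <= e) ->
  (t < chain_fun z -> strict_chain x) /\ (t < - chain_fun z -> ~~ strict_chain x).
Proof.
move=> t0; have [C C0 hC] := denominators_bounded.
pose e := t / (C * C) / 2.
have C2 : 0 < C * C by rewrite mulr_gt0.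
have e0 : 0 < e by rewrite !divr_gt0.
have BC p z : torus z -> 0 < B p.1 z * B p.2 z <= C * C.
  move=> Tz; have [[B1 _] [B2 _]] := (AB p.1 Tz, AB p.2 Tz).
  by rewrite mulr_gt0//= ler_pM ?hC ?ltW.
have sep u w : 0 < w <= C * C -> t < u * w -> 2 * e < u.
  move=> /andP[w0 wC] tuw.
  have u0 : 0 < u by rewrite -(pmulr_lgt0 _ w0) (lt_trans t0).
  rewrite /e mulrC divfK// ltr_pdivrMr//; apply: lt_le_trans tuw _.
  by rewrite ler_wpM2l// ltW.
exists e => // z x Tz xz; split=> h.
  apply/sorted_chainP => j k kj.
  have : t < gap (j, k) z.
    have t1 : t < 1.
      apply: lt_le_trans h _; rewrite /chain_fun; elim: consecutive => //= p l.
      by rewrite ge_min orbC => ->.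
    move: h; rewrite /chain_fun minfun_gt// all_map => /allP; apply.
    by rewrite mem_consecutive kj.
  rewrite gapE// => /(sep _ _ (BC (j, k) z Tz)) /=.
  by have := xz j; have := xz k; rewrite !ler_norml => /andP[? ?] /andP[? ?]; lra.
have : ~~ (- t <= chain_fun z) by rewrite -ltNge; lra.
rewrite /chain_fun minfun_ge; last by lra.
rewrite all_map -has_predC => /hasP[p]; rewrite mem_consecutive => /eqP pc /=.
rewrite -ltNge => hp; apply/negP => /sorted_chainP/(_ _ _ pc).
have : t < (ratfun_Re (f p.2) z - ratfun_Re (f p.1) z) * (B p.1 z * B p.2 z).
  by move: hp; rewrite gapE// => hp; rewrite -opprB mulNr ltrNr.
move=> /(sep _ _ (BC p z Tz)).
by have := xz p.1; have := xz p.2; rewrite !ler_norml => /andP[? ?] /andP[? ?] ? /=; lra.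
Qed.

End ChainFunction.

(** * Densities of chains along an orbit *)

Section ChainDensity.
Variables (R : realType) (m s D : nat) (theta : 'I_(m + s) -> R).
Variables (c : 'I_s -> rat) (b : 'I_m -> 'I_s -> rat).
Hypothesis theta_free : Qfree (angles_basis theta).
Hypothesis theta_coords : forall j : 'I_s,
  theta (rshift m j) =
  2 * pi * ratr (c j) + \sum_(k < m) ratr (b k j) * theta (lshift s k).
Variables (dO : measure_display) (Omega : measurableType dO).
Variables (P : probability Omega R) (Y : 'I_m -> {RV P >-> R[i]}).
Hypothesis Y_unif : forall k, uniform_on_circle (Y k).
Hypothesis Y_indep : independent_RVs Y.
Variable f : 'I_D -> ratfun R (m + s).
Hypothesis f_no_pole : forall j, no_pole_on_torus (f j).
Variables G rem : 'I_D -> R -> R.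
Hypothesis rem_o1 : forall j, rem j t @[t --> +oo] --> (0 : R).
Hypothesis G_def : forall j t, G j t = Fcurve theta f j t + rem j t.

Local Notation d := (lcm_denoms c b).
Local Notation shift_Y a w := (translate theta c b a (fun k => Y k w)).
Local Notation values z := (fun j => ratfun_Re (f j) z).

Definition strict_event a := [set w | strict_chain (values (shift_Y a w))].
Definition weak_event a := [set w | weak_chain (values (shift_Y a w))].
Local Notation pS a := (fine (P (strict_event a))).
Local Notation pW a := (fine (P (weak_event a))).

Lemma Fcurve_translate j (a : nat) (q : int) :
  Fcurve theta f j (a%:R + d%:R * q%:~R) =
  ratfun_Re (f j) (translate theta c b a (orbit_point (fun k => theta (lshift s k)) q%:~R)).
Proof.
rewrite /Fcurve; congr (ratfun_Re (f j)); apply/funext => i.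
exact: orbit_translate.
Qed.

(** The functions [h] and [- h] detect the strict chains and the failures of the
  weak ones, for the limit variable and, robustly, along the orbit. *)
Lemma chain_detector a : exists h : ('I_m -> R[i]) -> R,
  [/\ plfun h, strict_event a = [set w | 0 < h (fun k => Y k w)],
      weak_event a = ~` [set w | 0 < - h (fun k => Y k w)]
    & forall t : R, 0 < t -> \forall q \near \oo,
      let z := orbit_point (fun k => theta (lshift s k)) q%:R in
      let S := strict_chain (fun j => G j (a + d * q)%:R) in
      (t < h z -> S) /\ (t < - h z -> ~~ S)].
Proof.
have [A [B [pA pB AB]]] := ratfun_Re_family f_no_pole.
have TY w : torus (shift_Y a w) by apply: torus_translate; exact: torus_Y.
exists (fun y => chain_fun A B (translate theta c b a y)); split.
- by apply: plfun_comp; [exact: plfun_chain_fun|move=> i; exact: cpolyfun_translate].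
- by apply/seteqP; split=> w; rewrite /strict_event/= (strict_chain_funE AB).
- apply/seteqP; split=> w; rewrite /weak_event/= (weak_chain_funE AB)// oppr_gt0 ltNge.
    by move=> ->.
  by move/negP; rewrite negbK.
move=> t t0; have [e e0 he] := chain_fun_stable pB AB t0.
have near_rem : \forall q \near \oo, forall j, `|rem j (a + d * q)%:R| <= e.
  apply: filter_forall => j; have /cvgrPdist_le/(_ e e0) := rem_o1 j.
  move=> [M [_ hM]]; near=> q.
  have := hM (a + d * q)%:R; rewrite sub0r normrN; apply.
  apply: (@lt_le_trans _ _ q%:R); first by near: q; exact: nbhs_infty_gtr.
  by rewrite ler_nat (leq_trans _ (leq_addl _ _))// leq_pmull// lcm_denoms_gt0.
apply: filterS near_rem => q hq /=.
have Tz : torus (translate theta c b a (orbit_point (fun k => theta (lshift s k)) q%:R)).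
  by apply: torus_translate; exact: torus_orbit_point.
apply: he => // j; rewrite G_def natrD natrM -[q%:R]/(q%:~R).
by rewrite Fcurve_translate addrAC subrr add0r -[q%:~R]/(q%:R) -natrM -natrD.
Unshelve. all: by end_near. Qed.

Lemma measurable_chain_events a :
  measurable (strict_event a) /\ measurable (weak_event a).
Proof.
have [h [ph -> -> _]] := chain_detector a; split; first exact: measurable_gt.
by apply: measurableC; exact: (measurable_gt Y 0 (plfunN ph)).
Qed.

Lemma strict_eventE a : P (strict_event a) = (pS a)%:E.
Proof. by rewrite fineK// fin_num_measure//; exact: (measurable_chain_events _).1. Qed.

Lemma weak_eventE a : P (weak_event a) = (pW a)%:E.
Proof. by rewrite fineK// fin_num_measure//; exact: (measurable_chain_events _).2. Qed.

Lemma fine_prob_bounds (E : set Omega) : measurable E -> 0 <= fine (P E) <= 1.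
Proof.
move=> mE; rewrite -!lee_fin fineK ?fin_num_measure//.
by rewrite measure_ge0 probability_le1.
Qed.

Local Notation S := (fun n => strict_chain (fun j => G j n%:R)).

Lemma strict_density_ge (e : R) : 0 < e -> \forall X \near \oo,
  d%:R^-1 * \sum_(a < d) pS a <= chain_freq G X + e.
Proof.
apply: (@density_progressions R d S (fun a => pS a)); first exact: lcm_denoms_gt0.
  by move=> a; apply: fine_prob_bounds; exact: (measurable_chain_events _).1.
move=> a e1 e10; have [h [ph hS _ hq]] := chain_detector a.
rewrite hS.
apply: (orbit_frequency Y_unif Y_indep (angles_character theta_free)
  (S := fun q => S (a + d * q)%N) ph) => //.
move=> t t0; apply: filterS (hq t t0) => q; case=> + _; exact.
Qed.

(** The complement of the weak chain is the event [- h > 0] of the detector, to which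
  the lower bound applies. *)
Lemma weak_density_le (e : R) : 0 < e -> \forall X \near \oo,
  chain_freq G X <= d%:R^-1 * (\sum_(a < d) pW a) + e.
Proof.
move=> e0; have d0 := lcm_denoms_gt0 c b.
have dual : \forall X \near \oo, d%:R^-1 * \sum_(a < d) (1 - pW a) <=
    (count (fun n => ~~ S n) (iota 1 X))%:R / X%:R + e.
  apply: (@density_progressions R d (fun n => ~~ S n) (fun a => 1 - pW a)) => //.
    move=> a; have /andP[? ?] := fine_prob_bounds (measurable_chain_events a).2.
    by apply/andP; split; lra.
  move=> a e1 e10; have [h [ph _ hW hq]] := chain_detector a.
  have mh := measurable_gt Y 0 (plfunN ph).
  have -> : 1 - pW a = fine (P [set w | 0 < - h (fun k => Y k w)]).
    rewrite hW probability_setC// fineB ?fin_num_measure//.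
    by rewrite /= opprB addrC subrK.
  apply: (orbit_frequency Y_unif Y_indep (angles_character theta_free)
    (S := fun q => ~~ S (a + d * q)%N) (plfunN ph)) => // t t0.
  by apply: filterS (hq t t0) => q [].
near=> X.
have X0 : (0 < X)%N by near: X; exact: nbhs_infty_gt.
have : d%:R^-1 * \sum_(a < d) (1 - pW a) <=
    (count (fun n => ~~ S n) (iota 1 X))%:R / X%:R + e by near: X; exact: dual.
have dR : d%:R != 0 :> R by rewrite pnatr_eq0 -lt0n.
have XR : X%:R != 0 :> R by rewrite pnatr_eq0 -lt0n.
rewrite sumrB sumr_const card_ord mulrBr mulVf//.
have -> : (count (fun n => ~~ S n) (iota 1 X))%:R / X%:R = 1 - chain_freq G X.
  apply: (mulIf XR); rewrite /chain_freq divfK// mulrBl divfK// mul1r.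
  have /(congr1 (fun n => n%:R : R)) := count_predC S (iota 1 X).
  by rewrite size_iota natrD => <-; rewrite addrAC subrr add0r.
by set x := d%:R^-1 * _; lra.
Unshelve. all: by end_near. Qed.

Lemma chain_lower_density : ((d%:R^-1 * \sum_(a < d) pS a)%:E <= lower_density G)%E.
Proof. by apply: limn_einf_ge => e; exact: strict_density_ge. Qed.

Lemma chain_upper_density : (upper_density G <= (d%:R^-1 * \sum_(a < d) pW a)%:E)%E.
Proof. by apply: limn_esup_le => e; exact: weak_density_le. Qed.

Lemma strict_sub_weak a : strict_event a `<=` weak_event a.
Proof.
move=> w /sorted_chainP h; apply/sorted_chainP => j k kj.
exact/ltW/(h j k kj).
Qed.

(** Two consecutive functions that differ at one point of the orbit agree only on
  a null set, so the two events have the same probability. *)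
Lemma strict_weak_prob a :
  (forall j k : 'I_D, k = j.+1 :> nat -> exists q : int,
    Fcurve theta f j (a%:R + d%:R * q%:~R) <> Fcurve theta f k (a%:R + d%:R * q%:~R)) ->
  P (strict_event a) = P (weak_event a).
Proof.
move=> hdiff.
have [mS mW] := measurable_chain_events a.
have [A [B [pA pB AB]]] := ratfun_Re_family f_no_pole.
pose g p (y : 'I_m -> R[i]) := gap A B p (translate theta c b a y).
have pg p : polyfun (g p).
  by apply: polyfun_comp; [exact: polyfun_gap|move=> i; exact: cpolyfun_translate].
pose N (p : 'I_D * 'I_D) : set Omega :=
  if p.2 == p.1.+1 :> nat then [set w | g p (fun k => Y k w) = 0] else set0.
have N0 p : P (N p) = 0%E.
  rewrite /N; case: eqP => [pc|_]; last exact: measure0.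
  have [q hq] := hdiff p.1 p.2 pc.
  apply: (prob_zero_set Y_unif Y_indep (pg p)
    (torus_orbit_point (fun k => theta (lshift s k)) q%:~R)).
  have Tz : torus (translate theta c b a (orbit_point (fun k => theta (lshift s k)) q%:~R)).
    by apply: torus_translate; exact: torus_orbit_point.
  rewrite /g (gapE AB)// mulf_neq0//; last first.
    have [[B1 _] [B2 _]] := (AB p.1 _ Tz, AB p.2 _ Tz).
    by rewrite mulf_neq0// lt0r_neq0.
  by rewrite subr_eq0 -!Fcurve_translate; apply/eqP.
have mN p : measurable (N p).
  rewrite /N; case: ifP => // _.
  exact: (measurable_zero Y (plfun_poly (pg p))).
apply/eqP; rewrite eq_le; apply/andP; split.
  by apply: le_measure; rewrite ?inE//; exact: strict_sub_weak.
pose U := \bigcup_(p in [set: 'I_D * 'I_D]) N p.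
have mU : measurable U by apply: fin_bigcup_measurable => //; exact: finite_finset.
have PU : (P U <= 0)%E.
  have := @content_sub_fsum _ _ _ P _ setT U N finite_finset
    (fun p _ => mN p) mU (fun _ => id).
  by rewrite fsbig1// => p _; exact: N0.
apply: (@le_trans _ _ (P (strict_event a `|` U))).
  apply: le_measure; rewrite ?inE//; first exact: measurableU.
  move=> w /sorted_chainP hw.
  have [nN|] := pselect (exists p, N p w); first by right; have [p Np] := nN; exists p.
  move=> /forallNP nN; left; apply/sorted_chainP => j k kj.
  have := nN (j, k); rewrite /N /= kj eqxx /g => gn0.
  have Tz : torus (shift_Y a w) by apply: torus_translate; exact: torus_Y.
  have : values (shift_Y a w) k <= values (shift_Y a w) j := hw j k kj.
  rewrite le_eqVlt => /predU1P[e|//]; exfalso; apply: gn0.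
  by rewrite /= (gapE AB)//= e subrr mul0r.
by apply: le_trans (measureU2 _ _ _) _ => //; rewrite -[leRHS]adde0 leeD2l.
Qed.

End ChainDensity.

(** * The uniform law on the cyclic group of the degenerate case *)

(** The numerator of [x] is prime to its denominator. *)
Lemma dvdn_denq (x : rat) (k : nat) (n : int) : x * k%:R = n%:~R -> (`|denq x| %| k)%N.
Proof.
move=> xk; have h : numq x * k%:Z = n * denq x.
  apply: (@intr_inj rat); rewrite !intrM -xk numqE.
  by rewrite mulrAC.
have : (`|denq x| %| `|numq x| * k)%N.
  by have := congr1 absz h; rewrite !abszM => ->; exact: dvdn_mull.
by rewrite Gauss_dvdr// coprime_sym coprime_num_den.
Qed.

Section CyclicLaw.
Variables (R : realType) (s : nat) (theta : 'I_(0 + s) -> R).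
Variables (c : 'I_s -> rat) (b : 'I_0 -> 'I_s -> rat).
Hypothesis theta_coords : forall j : 'I_s,
  theta (rshift 0 j) =
  2 * pi * ratr (c j) + \sum_(k < 0) ratr (b k j) * theta (lshift s k).
Variables (dO : measure_display) (Omega : measurableType dO) (P : probability Omega R).
Variable Z : 'I_(0 + s) -> {RV P >-> R[i]}.
Hypothesis Z_unif : uniform_on_finite (cyclic_subgroup (nu theta)) Z.

Local Notation d := (lcm_denoms c b).

Definition nu_pow (a : nat) : 'I_(0 + s) -> R[i] := fun i => nu theta i ^+ a.

Lemma theta_degenerate (j : 'I_s) : theta (rshift 0 j) = 2 * pi * ratr (c j).
Proof. by rewrite theta_coords big_ord0 addr0. Qed.

Lemma ord0_rshift (i : 'I_(0 + s)) : exists j, i = rshift 0 j.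
Proof. by rewrite -(splitK i); case: fintype.split => [[]//|j]; exists j. Qed.

Lemma nu_pow_d i : nu theta i ^+ d = 1.
Proof.
have [j ->] := ord0_rshift i; have [n hn] := lcm_denoms_const c b j.
rewrite /nu -expi_nat theta_degenerate -mulrA.
have -> : ratr (c j) * d%:R = n%:~R :> R.
  by rewrite -(ratr_int R n) -hn rmorphM/= ratr_nat mulrC.
exact: expi_2pi_int.
Qed.

(** [d] is the order of [nu theta]: if [nu theta ^+ k = 1] then every
  denominator of the [c j] divides [k]. *)
Lemma nu_pow_inj (x y : nat) : (x < d)%N -> (y < d)%N -> nu_pow x = nu_pow y -> x = y.
Proof.
wlog xy : x y / (x <= y)%N => [hw xd yd exy|xd yd exy].
  by case: (leqP x y) => [xy|/ltnW yx]; [exact: hw|apply/esym; exact: hw].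
suff /dvdn_leq : (d %| y - x)%N.
  case: (posnP (y - x)) => [/eqP|yx0 /(_ isT)].
    by rewrite subn_eq0 => yx _; apply/eqP; rewrite eqn_leq xy.
  by rewrite leqNgt (leq_ltn_trans (leq_subr x y) yd).
apply/dvdn_biglcmP => j _; rewrite big_ord0 dvdn_lcm dvd1n andbT.
have := congr1 (fun z => z (rshift 0 j)) exy; rewrite /nu_pow /nu -!expi_nat => ej.
have : expi (theta (rshift 0 j) * (y - x)%:R) = 1 :> R[i].
  by rewrite natrB// mulrBr expiD expiN ej mulfV// unit_neq0// normc_expi.
move=> /expi_eq1[n]; rewrite theta_degenerate -mulrA => /(mulfI (lt0r_neq0 (pi2_gt0 R))).
move=> hn; apply: (@dvdn_denq _ _ n); apply: (@fmorph_inj _ _ (@ratr R)).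
by rewrite rmorphM/= ratr_nat ratr_int.
Qed.

Lemma cyclic_subgroupE :
  cyclic_subgroup (nu theta) = [set nu_pow a | a in [set: 'I_d]].
Proof.
have d0 := lcm_denoms_gt0 c b.
have nu0 i : nu theta i != 0 by apply: unit_neq0; exact: normc_expi.
apply/seteqP; split=> [_ [k _ <-]|_ [a _ <-]]; last by exists (a : nat)%:Z.
have dz : d%:Z != 0 by rewrite eqz_nat -lt0n.
have [q [e [-> e0 ed]]] : exists q e : int, [/\ k = d%:Z * q + e, 0 <= e & (absz e < d)%N].
  exists (k %/ d)%Z, (k %% d)%Z; rewrite mulrC -divz_eq modz_ge0//; split=> //.
  by rewrite -ltz_nat gez0_abs ?modz_ge0// ltz_pmod.
exists (Ordinal ed) => //; apply/funext => i; rewrite /nu_pow /= exprnP gez0_abs//.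
by rewrite expfzDr// -exprz_exp -[X in X ^ q]exprnP nu_pow_d exp1rz mul1r.
Qed.

Lemma card_cyclic_subgroup : #|` fset_set (cyclic_subgroup (nu theta))| = d.
Proof.
have [fA _] := Z_unif; rewrite -[RHS]card_ord cardE -(size_map (fun a : 'I_d => nu_pow a)).
apply/perm_size/uniq_perm; first exact: fset_uniq.
  rewrite map_inj_uniq ?enum_uniq// => x y /nu_pow_inj xy; apply: val_inj.
  by apply: xy; exact: ltn_ord.
move=> z; rewrite in_fset_set// cyclic_subgroupE; apply/idP/mapP.
  by rewrite inE => -[a _ <-]; exists a; rewrite ?mem_enum.
by move=> [a _ ->]; rewrite inE; exists a.
Qed.

Lemma measurable_singleton_event (z : 'I_(0 + s) -> R[i]) :
  measurable [set w | Z ^~ w = z].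
Proof.
have -> : [set w | Z ^~ w = z] = \bigcap_(i in [set: 'I_(0 + s)])
    ((fun w => complex.Re (Z i w)) @^-1` [set complex.Re (z i)] `&`
     (fun w => complex.Im (Z i w)) @^-1` [set complex.Im (z i)]).
  apply/seteqP; split=> w; first by move=> <-.
  move=> h; apply/funext => i; have [] := h i I; rewrite /=.
  by case: (Z i w) (z i) => [x y] [x' y'] /= -> ->.
apply: fin_bigcap_measurable => [|i _]; first exact: finite_finset.
by apply: measurableI; rewrite -[X in measurable X]setTI;
  [apply: (measurableT_comp (@measurable_Re R))|apply: (measurableT_comp (@measurable_Im R))].
Qed.

(** The events [Z = nu theta ^+ a] for [a < d] bound the probability of an event
  from below, and that of its complement too; the two bounds add up to [1]. *)
Lemma prob_cyclic (C : ('I_(0 + s) -> R[i]) -> bool) :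
  measurable [set w | C (Z ^~ w)] ->
  P [set w | C (Z ^~ w)] = (d%:R^-1 * \sum_(a < d) (C (nu_pow a))%:R)%:E.
Proof.
move=> mC; have d0 := lcm_denoms_gt0 c b.
have lower (C' : ('I_(0 + s) -> R[i]) -> bool) : measurable [set w | C' (Z ^~ w)] ->
    ((d%:R^-1 * \sum_(a < d) (C' (nu_pow a))%:R)%:E <= P [set w | C' (Z ^~ w)])%E.
  move=> mC'.
  pose E (a : 'I_d) := if C' (nu_pow a) then [set w | Z ^~ w = nu_pow a] else set0.
  have mE a : measurable (E a).
    by rewrite /E; case: ifP => // _; exact: measurable_singleton_event.
  have tE : trivIset [set: 'I_d] E.
    move=> x y _ _ [w []]; rewrite /E; case: ifP => // _ wx; case: ifP => // _ wy.
    apply: val_inj; apply: (nu_pow_inj (ltn_ord x) (ltn_ord y)).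
    exact: etrans (esym wx) wy.
  have -> : (d%:R^-1 * \sum_(a < d) (C' (nu_pow a))%:R)%:E = (\sum_(a < d) P (E a))%E.
    rewrite mulr_sumr -sumEFin; apply: eq_bigr => a _; rewrite /E.
    have [_ Z_prob] := Z_unif; case: (C' _); last by rewrite measure0 mulr0.
    rewrite Z_prob; last by rewrite cyclic_subgroupE; exists a.
    by rewrite card_cyclic_subgroup mulr1.
  rewrite -fsbig_finType -(measure_fin_bigcup P)//; last exact: finite_finset.
  apply: le_measure; rewrite ?inE//.
    by apply: fin_bigcup_measurable => //; exact: finite_finset.
  by move=> w [a _]; rewrite /E; case: ifP => // Ca Zw; rewrite /= Zw.
apply: le_anti; apply/andP; split; last exact: lower.
have mN : measurable [set w | ~~ C (Z ^~ w)].
  have -> : [set w | ~~ C (Z ^~ w)] = ~` [set w | C (Z ^~ w)].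
    by apply/seteqP; split=> w /= /negP.
  exact: measurableC.
have := lower (fun z => ~~ C z) mN.
have -> : [set w | ~~ C (Z ^~ w)] = ~` [set w | C (Z ^~ w)].
  by apply/seteqP; split=> w /= /negP.
rewrite probability_setC//.
have pf : P [set w | C (Z ^~ w)] \is a fin_num by rewrite fin_num_measure.
rewrite -(fineK pf) -EFinB !lee_fin.
have -> : \sum_(a < d) (~~ C (nu_pow a))%:R = d%:R - \sum_(a < d) (C (nu_pow a))%:R :> R.
  rewrite (_ : d%:R = \sum_(a < d) 1 :> R); last by rewrite sumr_const card_ord.
  rewrite -sumrB; apply: eq_bigr => a _.
  by case: (C _); rewrite ?subrr ?subr0.
by rewrite mulrBr mulVf ?pnatr_eq0 -?lt0n//; lra.
Qed.

End CyclicLaw.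

Lemma measurable_chain_event (R : realType) (r D : nat) (d : measure_display)
    (T : measurableType d) (X : 'I_r -> T -> R[i]) (f : 'I_D -> ratfun R r) :
  (forall i, measurable_fun setT (X i)) -> (forall w, torus (X ^~ w)) ->
  (forall j, no_pole_on_torus (f j)) ->
  measurable [set w | strict_chain (fun j => ratfun_Re (f j) (X ^~ w))] /\
  measurable [set w | weak_chain (fun j => ratfun_Re (f j) (X ^~ w))].
Proof.
move=> mX TX f_no_pole.
have [A [B [pA pB AB]]] := ratfun_Re_family f_no_pole.
have mh := measurable_plfun mX (plfun_chain_fun pA pB).
split.
  have := measurable_fun_ltr (measurable_cst (0 : R)) mh => /(_ measurableT [set true] I).
  rewrite setTI; congr measurable; apply/seteqP.
  by split=> w; rewrite /= (strict_chain_funE AB).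
have := measurable_fun_ler (measurable_cst (0 : R)) mh => /(_ measurableT [set true] I).
rewrite setTI; congr measurable; apply/seteqP.
by split=> w; rewrite /= (weak_chain_funE AB).
Qed.

(** * The two cases of the theorem *)

Section Cases.
Variables (R : realType) (D : nat) (dO : measure_display) (Omega : measurableType dO).
Variable P : probability Omega R.
Variables G rem : 'I_D -> R -> R.
Hypothesis rem_o1 : forall j, rem j t @[t --> +oo] --> (0 : R).

Lemma density_squeeze (v w : \bar R) :
  (v <= lower_density G)%E -> (upper_density G <= w)%E -> v = w -> has_density G v.
Proof.
move=> vl uw vw; have lu : (lower_density G <= upper_density G)%E by exact: limn_einf_sup.
have lv : lower_density G = v.
  by apply/eqP; rewrite eq_le vl (le_trans lu) ?vw.
split=> //; apply/eqP; rewrite eq_le lu/= lv vw.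
exact: uw.
Qed.

(** There is no free angle, so the translates [nu ^ a] are constant and their
  events have probability [0] or [1]. *)
Lemma degenerate_case (s : nat) (theta : 'I_(0 + s) -> R)
    (c : 'I_s -> rat) (b : 'I_0 -> 'I_s -> rat) (Z : 'I_(0 + s) -> {RV P >-> R[i]})
    (f : 'I_D -> ratfun R (0 + s)) :
  Qfree (angles_basis theta) ->
  (forall j : 'I_s, theta (rshift 0 j) =
    2 * pi * ratr (c j) + \sum_(k < 0) ratr (b k j) * theta (lshift s k)) ->
  (forall w, torus (Z ^~ w)) ->
  uniform_on_finite (cyclic_subgroup (nu theta)) Z ->
  (forall j, no_pole_on_torus (f j)) ->
  (forall j t, G j t = Fcurve theta f j t + rem j t) ->
  [/\ (strict_prob P f (fun w i => Z i w) <= lower_density G)%E,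
      (lower_density G <= upper_density G)%E,
      (upper_density G <= weak_prob P f (fun w i => Z i w))%E
    & (forall j k : 'I_D, k = j.+1 :> nat ->
         forall n : int, Fcurve theta f j n%:~R <> Fcurve theta f k n%:~R) ->
      has_density G (strict_prob P f (fun w i => Z i w))].
Proof.
move=> free coords TZ Z_unif f_no_pole G_def.
have Y : 'I_0 -> {RV P >-> R[i]} by case.
have Y_unif k : uniform_on_circle (Y k) by case: k.
have Y_indep : independent_RVs Y.
  move=> A _; rewrite big_ord0 -(probability_setT P); congr (P _).
  by apply/seteqP; split=> // w _ [].
pose d := lcm_denoms c b.
have translate_nu a y : translate theta c b a y = nu_pow theta a.
  apply/funext => i; have [j ->] := ord0_rshift i.
  by rewrite /translate /monomials (unsplitK (inr j)) big_ord0 mulr1.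
have const_prob (B : bool) : fine (P [set w | B]) = B%:R.
  case: B; last by rewrite (_ : [set _ | _] = set0) ?measure0//; apply/seteqP; split.
  by rewrite (_ : [set _ | _] = setT) ?probability_setT//; apply/seteqP; split.
have mZ i : measurable_fun setT (Z i) by [].
have [mS mW] := measurable_chain_event mZ TZ f_no_pole.
have strictE a : fine (P (strict_event theta c b Y f a)) =
    (strict_chain (fun j => ratfun_Re (f j) (nu_pow theta a)))%:R.
  have -> : strict_event theta c b Y f a = [set _ |
      strict_chain (fun j => ratfun_Re (f j) (nu_pow theta a))].
    by apply/seteqP; split=> w; rewrite /strict_event/= translate_nu.
  exact: const_prob.
have weakE a : fine (P (weak_event theta c b Y f a)) =
    (weak_chain (fun j => ratfun_Re (f j) (nu_pow theta a)))%:R.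
  have -> : weak_event theta c b Y f a = [set _ |
      weak_chain (fun j => ratfun_Re (f j) (nu_pow theta a))].
    by apply/seteqP; split=> w; rewrite /weak_event/= translate_nu.
  exact: const_prob.
have sE : strict_prob P f (fun w i => Z i w) =
    (d%:R^-1 * \sum_(a < d) fine (P (strict_event theta c b Y f a)))%:E.
  rewrite (eq_bigr _ (fun (a : 'I_d) _ => strictE a)).
  exact: (prob_cyclic coords Z_unif
    (C := fun z => strict_chain (fun j => ratfun_Re (f j) z)) mS).
have wE : weak_prob P f (fun w i => Z i w) =
    (d%:R^-1 * \sum_(a < d) fine (P (weak_event theta c b Y f a)))%:E.
  rewrite (eq_bigr _ (fun (a : 'I_d) _ => weakE a)).
  exact: (prob_cyclic coords Z_unif
    (C := fun z => weak_chain (fun j => ratfun_Re (f j) z)) mW).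
have low := chain_lower_density free coords Y_unif Y_indep f_no_pole rem_o1 G_def.
have up := chain_upper_density free coords Y_unif Y_indep f_no_pole rem_o1 G_def.
rewrite sE wE; split=> //; first exact: limn_einf_sup.
move=> hdiff; apply: (density_squeeze low up).
have sw (a : nat) : P (strict_event theta c b Y f a) = P (weak_event theta c b Y f a).
  apply: (strict_weak_prob coords Y_unif Y_indep f_no_pole rem_o1 G_def).
  move=> j k kj.
  by exists 0; have := hdiff j k kj a; rewrite mulr0 addr0; exact.
by under eq_bigr do rewrite sw.
Qed.

(** The vector [nu ^ a * Z] is the translate of [Y], up to which this is the bound
  along the orbit. *)
Lemma nondegenerate_case (m s : nat) (theta : 'I_(m + s) -> R)
    (c : 'I_s -> rat) (b : 'I_m -> 'I_s -> rat) (Z : 'I_(m + s) -> {RV P >-> R[i]})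
    (Y : 'I_m -> {RV P >-> R[i]}) (f : 'I_D -> ratfun R (m + s)) :
  let d := lcm_denoms c b in
  let shifted a := fun w i => nu theta i ^+ a * Z i w in
  Qfree (angles_basis theta) ->
  (forall j : 'I_s, theta (rshift m j) =
    2 * pi * ratr (c j) + \sum_(k < m) ratr (b k j) * theta (lshift s k)) ->
  (forall k, uniform_on_circle (Y k)) -> independent_RVs Y ->
  (forall k w, Z (lshift s k) w = Y k w ^+ d) ->
  (forall j w, Z (rshift m j) w = \prod_(k < m) Y k w ^ hcoef c b k j) ->
  (forall j, no_pole_on_torus (f j)) ->
  (forall j t, G j t = Fcurve theta f j t + rem j t) ->
  [/\ ((d%:R^-1)%:E * \sum_(0 <= a < d) strict_prob P f (shifted a)
         <= lower_density G)%E,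
      (lower_density G <= upper_density G)%E,
      (upper_density G
         <= (d%:R^-1)%:E * \sum_(0 <= a < d) weak_prob P f (shifted a))%E
    & (forall (j k : 'I_D) (a : nat), k = j.+1 :> nat -> (a < d)%N ->
         exists n : int, (n = a %[mod d])%Z /\
           Fcurve theta f j n%:~R <> Fcurve theta f k n%:~R) ->
      has_density G
        ((d%:R^-1)%:E * \sum_(0 <= a < d) strict_prob P f (shifted a))%E].
Proof.
move=> d shifted free coords Y_unif Y_indep Zl Zr f_no_pole G_def.
have shiftedE a w : shifted a w = translate theta c b a (fun k => Y k w).
  apply/funext => i; rewrite /shifted /translate; congr (_ * _).
  rewrite -(splitK i); case: fintype.split => [k|j] /=.
    by rewrite monomials_lshift Zl.
  by rewrite monomials_rshift ?Zr//; exact: torus_Y.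
have eS a : strict_prob P f (shifted a) = (fine (P (strict_event theta c b Y f a)))%:E.
  have aE : [set w | strict_chain (fun j => ratfun_Re (f j) (shifted a w))] =
      strict_event theta c b Y f a.
    by apply/seteqP; split=> w; rewrite /strict_event/= shiftedE.
  rewrite /strict_prob aE.
  exact: (strict_eventE coords Y_unif f_no_pole rem_o1 G_def a).
have eW a : weak_prob P f (shifted a) = (fine (P (weak_event theta c b Y f a)))%:E.
  have aE : [set w | weak_chain (fun j => ratfun_Re (f j) (shifted a w))] =
      weak_event theta c b Y f a.
    by apply/seteqP; split=> w; rewrite /weak_event/= shiftedE.
  rewrite /weak_prob aE.
  exact: (weak_eventE coords Y_unif f_no_pole rem_o1 G_def a).
have low := chain_lower_density free coords Y_unif Y_indep f_no_pole rem_o1 G_def.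
have up := chain_upper_density free coords Y_unif Y_indep f_no_pole rem_o1 G_def.
have -> : ((d%:R^-1)%:E * \sum_(0 <= a < d) strict_prob P f (shifted a) =
    (d%:R^-1 * \sum_(a < d) fine (P (strict_event theta c b Y f a)))%:E)%E.
  by rewrite big_mkord (eq_bigr _ (fun (a : 'I_d) _ => eS a)) sumEFin.
have -> : ((d%:R^-1)%:E * \sum_(0 <= a < d) weak_prob P f (shifted a) =
    (d%:R^-1 * \sum_(a < d) fine (P (weak_event theta c b Y f a)))%:E)%E.
  by rewrite big_mkord (eq_bigr _ (fun (a : 'I_d) _ => eW a)) sumEFin.
split=> //; first exact: limn_einf_sup.
move=> hdiff; apply: (density_squeeze low up).
have sw (a : 'I_d) : P (strict_event theta c b Y f a) = P (weak_event theta c b Y f a).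
  apply: (strict_weak_prob coords Y_unif Y_indep f_no_pole rem_o1 G_def).
  move=> j k kj; have [n [/eqP na nF]] := hdiff j k a kj (ltn_ord a).
  have /dvdzP[q nq] : (d %| n - a%:Z)%Z by rewrite -eqz_mod_dvd.
  exists q; suff <- : n%:~R = a%:R + d%:R * q%:~R :> R by [].
  by rewrite -(subrK (a%:Z) n) nq intrD intrM addrC mulrC.
by under eq_bigr do rewrite sw.
Qed.

End Cases.

Theorem theorem3p1 (R : realType) (m s D : nat)
    (theta : 'I_(m + s) -> R)
    (c : 'I_s -> rat) (b : 'I_m -> 'I_s -> rat)
    (theta_basis : Qbasis (angles_span theta) (angles_basis theta))
    (theta_coords : forall j : 'I_s,
       theta (rshift m j) =
       2 * pi * ratr (c j) + \sum_(k < m) ratr (b k j) * theta (lshift s k))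
    (dO : measure_display) (Omega : measurableType dO)
    (P : probability Omega R)
    (Z : 'I_(m + s) -> {RV P >-> R[i]})
    (Z_law : is_Ztheta theta c b Z)
    (f : 'I_D -> ratfun R (m + s))
    (f_no_pole : forall j, no_pole_on_torus (f j))
    (f_real : forall j, real_on_torus (f j))
    (G rem : 'I_D -> R -> R)
    (rem_o1 : forall j, rem j t @[t --> +oo] --> (0 : R))
    (G_def : forall j t, G j t = Fcurve theta f j t + rem j t) :
  let F := Fcurve theta f in
  let d := lcm_denoms c b in
  let Ztheta := fun w i => Z i w in
  let shifted a := fun w i => nu theta i ^+ a * Z i w in
  ((forall i, in_piQ (theta i)) ->
    [/\ (strict_prob P f Ztheta <= lower_density G)%E,
        (lower_density G <= upper_density G)%E,
        (upper_density G <= weak_prob P f Ztheta)%E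
      & (forall j k : 'I_D, k = j.+1 :> nat ->
           forall n : int, F j n%:~R <> F k n%:~R) ->
        has_density G (strict_prob P f Ztheta)])
  /\
  ((exists i, ~ in_piQ (theta i)) ->
    [/\ ((d%:R^-1)%:E * \sum_(0 <= a < d) strict_prob P f (shifted a)
           <= lower_density G)%E,
        (lower_density G <= upper_density G)%E,
        (upper_density G
           <= (d%:R^-1)%:E * \sum_(0 <= a < d) weak_prob P f (shifted a))%E
      & (forall (j k : 'I_D) (a : nat), k = j.+1 :> nat -> (a < d)%N ->
           exists n : int, (n = a %[mod d])%Z /\ F j n%:~R <> F k n%:~R) ->
        has_density G
          ((d%:R^-1)%:E * \sum_(0 <= a < d) strict_prob P f (shifted a))%E]).
Proof.
cbv zeta; have [free _] := theta_basis; have [TZ lawZ] := Z_law; split.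
  move=> all_piQ.
  have m0 : m = 0%N.
    apply/eqP; rewrite -leqn0 leqNgt; apply/negP => m_gt0.
    (* A rational multiple of [pi] among the first [m] angles is dependent on
       [2 * pi]. *)
    pose k := Ordinal m_gt0; have [q hq] := all_piQ (lshift s k).
    pose a (o : option 'I_m) : rat :=
      if o is Some k' then (k' == k)%:R else - (q / 2).
    have : a =1 (fun=> 0).
      apply: free; rewrite (bigD1 None)//= (bigD1 (Some k))//=. rewrite rmorph1 mul1r hq.
      rewrite big1 ?addr0 => [|[k'|]//]; last first.
        move=> /andP[_ kk]; have /negbTE k'k : k' != k by apply: contra kk => /eqP ->.
        by rewrite /= k'k ratr_nat mul0r.
      by rewrite rmorphN fmorph_div/= ratr_nat; field.
    by move=> /(_ (Some k))/eqP; rewrite /a eqxx oner_eq0.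
  subst m.
  exact: (degenerate_case rem_o1 free theta_coords TZ lawZ f_no_pole G_def).
move=> [i0 not_piQ].
have m0 : m != 0%N.
  apply/eqP => m0; apply: not_piQ; subst m.
  have [j ->] := ord0_rshift i0; exists (2 * c j).
  by rewrite (theta_degenerate theta_coords) rmorphM/= ratr_nat; ring.
move: lawZ; rewrite (negbTE m0) => -[Y [Y_unif Y_indep Zl Zr]].
exact: (nondegenerate_case rem_o1 free theta_coords Y_unif Y_indep Zl Zr f_no_pole G_def).
Qed.
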